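(* Let $\mathbb{k}$ be an algebraically closed field with $\mathrm{char}(\mathbb{k})\neq 2$, and let $\mathfrak{g}=\mathfrak{sl}(1|1)$ over $\mathbb{k}$, with $\hat H$ and $L_{(\mathfrak{h},\phi)}$ as defined in the context. For any $2$-dimensional subalgebra $\mathfrak{h}$ of $\mathfrak{g}$ and any $\mathbb{Z}_2$-graded linear functional $\phi\in\mathfrak{h}^*$, the $\hat H$-module $L_{(\mathfrak{h},\phi)}$ is a $\mathbb{Z}_2$-graded line module over $\hat H$. Conversely, for any $\mathbb{Z}_2$-graded line module $L$ over $\hat H$ on which $t$ acts without torsion, $L\cong L_{(\mathfrak{h},\phi)}$ for some $2$-dimensional subalgebra $\mathfrak{h}$ of $\mathfrak{g}$ and some $\mathbb{Z}_2$-graded linear functional $\phi\in\mathfrak{h}^*$.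
   Context: Lie superalgebra: $\mathfrak{g}=\mathfrak{sl}(1|1)$ is the set of $2\times 2$ matrices $\begin{bmatrix} a&b\\c&d\end{bmatrix}$ over $\mathbb{k}$ with $a-d=0$. It has basis $e=\begin{bmatrix}0&1\\0&0\end{bmatrix}$, $f=\begin{bmatrix}0&0\\1&0\end{bmatrix}$, $h=\begin{bmatrix}1&0\\0&1\end{bmatrix}$, is $\mathbb{Z}_2$-graded with $\mathfrak{g}_{\overline 0}=\mathbb{k}h$, $\mathfrak{g}_{\overline 1}=\mathbb{k}e\oplus\mathbb{k}f$, and has bilinear superbracket given by $[X,Y]=XY-(-1)^{|X||Y|}YX$ for homogeneous $X,Y$, so $[e,f]=[f,e]=h$ and all other brackets of basis elements are $0$. A subalgebra of $\mathfrak{g}$ means any subspace closed under the superbracket (not required to be graded). The $2$-dimensional subalgebras are exactly the subspaces $\mathfrak{h}=\mathbb{k}h\oplus\mathbb{k}(\alpha e+\beta f)$ with $(\alpha,\beta)\in\mathbb{P}^1$. For such $\mathfrak{h}$, a functional $\phi\in\mathfrak{h}^*$ is called $\mathbb{Z}_2$-graded if $\phi(\alpha e+\beta f)=0$. Algebra: $\hat H=\mathbb{k}\langle e,f,h,t\rangle/\langle ef+fe-ht,\ he-eh,\ hf-fh,\ et-te,\ ft-tf,\ ht-th\rangle$. It is $\mathbb{Z}$-graded with $e,f,h,t$ in degree $1$, and also $\mathbb{Z}_2$-graded with $|e|=|f|=\overline 1$, $|h|=|t|=\overline 0$. Modules: modules are left modules. A line module over $\hat H$ is a ($\mathbb{Z}$-)graded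 cyclic $\hat H$-module with Hilbert series $1/(1-x)^2$. It is $\mathbb{Z}_2$-graded if, in addition, it carries a $\mathbb{Z}_2$-grading compatible with its $\mathbb{Z}$-grading (each $\mathbb{Z}$-homogeneous component is the direct sum of its $\mathbb{Z}_2$-components) and with the $\mathbb{Z}_2$-grading of $\hat H$. The central element $t$ acts without torsion on $L$ if no nonzero element of $L$ is annihilated by $t$. For $\mathfrak{h}=\mathbb{k}h\oplus\mathbb{k}(\alpha e+\beta f)$ with $(\alpha,\beta)\in\mathbb{P}^1$ and $\phi\in\mathfrak{h}^*$, define $$L_{(\mathfrak{h},\phi)}=\frac{\hat H}{\hat H(h-\phi(h)t)+\hat H(\alpha e+\beta f-\phi(\alpha e+\beta f)t)}.$$ *)

(* Defs.v *)
From HB Require Import structures.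
From mathcomp Require Import all_boot all_order all_algebra.
From mathcomp Require Import boolp.
From mathcomp Require Import ring_quotient generic_quotient.
From mathcomp Require Import ring.
From mathcomp Require Import finmap monalg.

Set Implicit Arguments.
Unset Strict Implicit.
Unset Printing Implicit Defensive.

Import GRing.Theory.

Local Open Scope ring_scope.
Local Open Scope quotient_scope.

Section LieSuperalgebra.

Variable k : closedFieldType.

Definition sl11 : {pred 'M[k]_2} := [pred X : 'M[k]_2 | X 0 0 - X 1 1 == 0].

Definition e_mx : 'M[k]_2 := delta_mx 0 1.
Definition f_mx : 'M[k]_2 := delta_mx 1 0.
Definition h_mx : 'M[k]_2 := 1%:M.

(* Diagonal entries are even and off-diagonal entries are odd. *)
Definition parity_comp (i : 'Z_2) (X : 'M[k]_2) : 'M[k]_2 :=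
  \matrix_(r < 2, c < 2) (if (r + c)%:R == i then X r c else 0).

(* The bilinear extension of XY - (-1)^(|X||Y|) YX on homogeneous X, Y. *)
Definition sbracket (X Y : 'M[k]_2) : 'M[k]_2 :=
  \sum_(i : 'Z_2) \sum_(j : 'Z_2)
    (parity_comp i X *m parity_comp j Y
     - (-1) ^+ (i * j)%N *: (parity_comp j Y *m parity_comp i X)).

Definition subalgebra (U : {vspace 'M[k]_2}) : Prop :=
  {subset U <= sl11} /\ {in U &, forall X Y, sbracket X Y \in U}.

(* The pair (a, b) gives homogeneous coordinates of a point of P^1 such that
   U = k h + k (a e + b f). *)
Definition presents (U : {vspace 'M[k]_2}) (a b : k) : Prop :=
  (a, b) != (0, 0)
  /\ U = (<[h_mx]> + <[a *: e_mx + b *: f_mx]>)%VS.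

(* vsproj U inverts the inclusion subvs_of U -> 'M[k]_2 on U; the value is
   meaningful only for X in U. *)
Definition fapp (U : {vspace 'M[k]_2}) (phi : 'Hom(subvs_of U, k^o))
  (X : 'M[k]_2) : k := phi (vsproj U X).

Lemma sbracketE (X Y : 'M[k]_2) : X \in sl11 -> Y \in sl11 ->
  sbracket X Y = (X 0 1 * Y 1 0 + X 1 0 * Y 0 1)%:M.
Proof.
rewrite !inE !subr_eq0 => /eqP HX /eqP HY.
have E0 (Z : 'M[k]_2) : Z 0 0 = Z 1 1 -> parity_comp ord0 Z = (Z 0 0)%:M.
  move=> HZ; apply/matrixP=> i j; rewrite !mxE.
  by case: i => [[|[|]]] // ?; case: j => [[|[|]]] // ?;
    rewrite /= ?mulr1n ?mulr0n //; [|rewrite HZ]; congr (Z _ _); exact: val_inj.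
have E1 (Z : 'M[k]_2) :
    parity_comp (lift ord0 ord0) Z = Z 0 1 *: e_mx + Z 1 0 *: f_mx.
  apply/matrixP=> i j; rewrite !mxE.
  by case: i => [[|[|]]] // ?; case: j => [[|[|]]] // ?;
    rewrite /= ?(mulr0, mulr1, addr0, add0r) //; congr (Z _ _); exact: val_inj.
rewrite /sbracket !big_ord_recl !big_ord0 !E0 // !E1.
rewrite !mul0n ?muln0 !expr0 !scale1r expr1 scaleN1r !addr0 opprK.
rewrite (mul_scalar_mx (X 0 0)) (mul_scalar_mx (Y 0 0)).
rewrite !mul_scalar_mx !mul_mx_scalar !subrr ?add0r.
rewrite !(mulmxDl, mulmxDr) -!scalemxAl -!scalemxAr.
rewrite /e_mx /f_mx !mul_delta_mx_cond /=.
apply/matrixP=> i j; rewrite !mxE.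
by case: (i : 'I_2) => [[|[|]]] // ?; case: (j : 'I_2) => [[|[|]]] // ?; rewrite /=; ring.
Qed.

Lemma sl11P (X : 'M[k]_2) :
  reflect (X = X 0 0 *: h_mx + (X 0 1 *: e_mx + X 1 0 *: f_mx)) (X \in sl11).
Proof.
rewrite inE subr_eq0; apply: (iffP eqP) => [HX|->]; last first.
  by rewrite !mxE /=; ring.
apply/matrixP=> i j; rewrite !mxE.
by case: i => [[|[|]]] // ?; case: j => [[|[|]]] // ?;
  rewrite /= ?(mulr0, mulr1, addr0, add0r) //;
  do ?[by congr (X _ _); exact: val_inj];
  by rewrite HX; congr (X _ _); exact: val_inj.
Qed.

Lemma dim_presents (U : {vspace 'M[k]_2}) a b : presents U a b -> \dim U = 2%N.
Proof.
case=> nz ->; set w := _ + _.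
have [h01 h10] : h_mx 0 1 = 0 /\ h_mx 1 0 = 0 by rewrite !mxE.
have [w01 w10] : w 0 1 = a /\ w 1 0 = b by rewrite !mxE /=; split; ring.
have wh : w \notin <[h_mx]>%VS.
  apply: contraNN nz => /vlineP[c wE].
  by rewrite -w01 -w10 wE !mxE /= !mulr0n mulr0.
have wn0 : w != 0 by apply: contraNneq wh => ->; rewrite mem0v.
rewrite dimv_disjoint_sum ?dim_vline ?wn0.
  suff -> : h_mx != 0 by [].
  by apply/eqP=> /matrixP/(_ 0 0)/eqP; rewrite !mxE oner_eq0.
apply/eqP; rewrite -subv0; apply/subvP=> x; rewrite memv_cap => /andP[xh /vlineP[c xE]].
case: (eqVneq c 0) => [c0|c0]; first by rewrite xE c0 scale0r mem0v.
by case/negP: wh; rewrite -[w](scalerK c0) -xE memvZ.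
Qed.

(* Every 2-dimensional subalgebra is of the form described by presents. *)
Lemma subalgebra2P (U : {vspace 'M[k]_2}) : 2%N \notin [pchar k] ->
  (subalgebra U /\ \dim U = 2%N) <-> exists a b, presents U a b.
Proof.
move=> char2; have n2 : (2%:R : k) != 0 by move: char2; rewrite inE.
split=> [[[Usl Ubr] dU]|[a [b Uab]]]; last first.
  split; last exact: dim_presents Uab.
  case: Uab => _ UE.
  have hU : h_mx \in U by rewrite UE (subvP (addvSl _ _)) ?memv_line.
  have Usl : {subset U <= sl11}.
    move=> X; rewrite UE => /memv_addP[_ /vlineP[c ->] [_ /vlineP[d ->] ->]].
    by rewrite inE !mxE /=; apply/eqP; ring.
  by split=> // X Y XU YU; rewrite sbracketE ?Usl // -scalemx1 memvZ.
have hU : h_mx \in U.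
  have off0 X : X \in U -> X != 0 -> X 0 1 = 0 -> X 1 0 = 0 -> h_mx \in U.
    move=> XU X0 X01 X10; have /sl11P XE := Usl X XU.
    have XE' : X = X 0 0 *: h_mx by rewrite {1}XE X01 X10 !scale0r !addr0.
    have c0 : X 0 0 != 0 by apply: contraNneq X0 => c0; rewrite XE' c0 scale0r.
    by rewrite -[h_mx](scalerK c0) -XE' memvZ.
  have := vbasisP U; move: (vbasis U); rewrite dU => B BU.
  have fB := basis_free BU.
  have memB i : B`_i \in U.
    have [lt|ge] := ltnP i (size B); last by rewrite nth_default ?mem0v.
    by apply: (basis_mem BU); rewrite mem_nth.
  have lin0 (c d : k) : c *: B`_0 + d *: B`_1 = 0 -> c = 0 /\ d = 0.
    move=> cd0; have /freeP/(_ (fun i => [:: c; d]`_i)) := fB.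
    rewrite !big_ord_recl big_ord0 addr0 /= => /(_ cd0) F.
    by split; [exact: (F 0)|exact: (F 1)].
  set u := B`_0 in lin0; set v := B`_1 in lin0.
  have uU : u \in U := memB 0%N.
  have vU : v \in U := memB 1%N.
  pose D := u 0 1 * v 1 0 - u 1 0 * v 0 1.
  have [D0|D0] := eqVneq D 0; last first.
    pose x := D^-1 *: ((v 1 0 - v 0 1) *: u + (u 0 1 - u 1 0) *: v).
    have xU : x \in U by rewrite memvZ // memvD // memvZ.
    have x01 : x 0 1 = 1.
      by rewrite !mxE -[RHS](mulVf D0); congr (_ * _); rewrite /D; ring.
    have x10 : x 1 0 = 1.
      by rewrite !mxE -[RHS](mulVf D0); congr (_ * _); rewrite /D; ring.
    have := Ubr x x xU xU; rewrite sbracketE ?Usl // x01 x10 !mulr1 => mem2.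
    by rewrite -[h_mx](scalerK n2) memvZ // scalemx1.
  have [z1|nz1] := eqVneq (v 1 0 *: u - u 1 0 *: v) 0; last first.
    apply: off0 nz1 _ _; rewrite ?memvB ?memvZ // !mxE; last by ring.
    by rewrite -D0 /D; ring.
  have [z2|nz2] := eqVneq (v 0 1 *: u - u 0 1 *: v) 0; last first.
    apply: off0 nz2 _ _; rewrite ?memvB ?memvZ // !mxE; first by ring.
    by apply/eqP; rewrite -oppr_eq0 -[X in _ == X]D0 /D; apply/eqP; ring.
  have u0 : u != 0.
    apply/eqP=> u0; have [] := lin0 1 0; first by rewrite scale0r addr0 u0 scaler0.
    by move/eqP; rewrite oner_eq0.
  apply: (off0 u) => //.
    have [] := lin0 (v 0 1) (- u 0 1); first by rewrite scaleNr.
    by move=> _ /eqP; rewrite oppr_eq0 => /eqP.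
  have [] := lin0 (v 1 0) (- u 1 0); first by rewrite scaleNr.
  by move=> _ /eqP; rewrite oppr_eq0 => /eqP.
have [Uh|] := boolP (U <= <[h_mx]>)%VS.
  by have := dimvS Uh; rewrite dU dim_vline; case: (_ != 0).
case/subvPn=> w wU wh; have /sl11P wE := Usl w wU.
exists (w 0 1), (w 1 0); set x := _ *: e_mx + _ in wE.
have xU : x \in U.
  by rewrite -[x](addKr (w 0 0 *: h_mx)) -wE memvD // ?memvN memvZ.
have nz : (w 0 1, w 1 0) != (0, 0).
  apply: contraNneq wh => -[a0 b0].
  by rewrite wE /x a0 b0 !scale0r !addr0 memvZ ?memv_line.
split=> //; apply/eqP; rewrite eq_sym eqEdim dU (@dim_presents _ (w 0 1) (w 1 0)) // andbT.
by rewrite subv_add -!memvE hU.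
Qed.

End LieSuperalgebra.

Lemma malg_scaleAr (K : monomType) (R : comNzRingType) (c : R)
  (x y : {malg R[K]}) : c *: (x * y) = x * (c *: y).
Proof.
have comC : c%:MP * x = x * c%:MP.
  apply/malgP=> m; rewrite mcoeffCM (mcoeffMrw _ (fsubset_refl _) msuppU_le).
  rewrite big_seq_fset1 mcoeffUU mulrC.
  transitivity (mcoeff m (\sum_(m1 <- msupp x) << x@_m1 * c *g m1 >>)).
    rewrite raddf_sum /= {1}[x]monalgE raddf_sum /= mulr_suml.
    by apply: eq_bigr => m1 _; rewrite !mcoeffU mulrnAl.
  by rewrite raddf_sum /=; apply: eq_bigr => m1 _; rewrite mcoeffU mulm1.
by rewrite -!mul_malgC mulrA comC mulrA.
Qed.

Inductive two_sided_ideal (A : nzRingType) (S : A -> Prop) : A -> Prop :=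
| Ideal0 : two_sided_ideal S 0
| IdealGen x : S x -> two_sided_ideal S x
| IdealD x y :
    two_sided_ideal S x -> two_sided_ideal S y -> two_sided_ideal S (x + y)
| IdealMl a x : two_sided_ideal S x -> two_sided_ideal S (a * x)
| IdealMr a x : two_sided_ideal S x -> two_sided_ideal S (x * a).

Lemma ideal_rmorph0 (A B : nzRingType) (g : {rmorphism A -> B})
  (S : A -> Prop) x :
  (forall r, S r -> g r = 0) -> two_sided_ideal S x -> g x = 0.
Proof.
move=> gS; elim=> [|//|y z _ + _|a y _|a y _].
- by rewrite rmorph0.
- by rewrite rmorphD => -> ->; rewrite addr0.
- by rewrite rmorphM => ->; rewrite mulr0.
- by rewrite rmorphM => ->; rewrite mul0r.
Qed.

Definition relations (A : nzRingType) (E F H T : A) : seq A :=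
  [:: E * F + F * E - H * T; H * E - E * H; H * F - F * H;
      E * T - T * E; F * T - T * F; H * T - T * H].

Lemma relations_rmorph0 (A B : nzRingType) (g : {rmorphism A -> B})
    (E F H T : A) : g E = 0 -> g F = 0 -> g H = 0 -> g T = 0 ->
  forall r, r \in relations E F H T -> g r = 0.
Proof.
move=> gE gF gH gT r; rewrite !inE.
by move=> /or4P[/eqP->|/eqP->|/eqP->|/or3P[]/eqP->];
   rewrite !(rmorphB, rmorphD, rmorphM) /= ?gE ?gF ?gH ?gT
           ?(mulr0, mul0r) ?addr0 subr0.
Qed.

(* MathComp only gives the quotient by a two-sided ideal its ring structure
   when the ring is commutative, so it is rebuilt here. *)
Section AlgebraH.

Variable k : closedFieldType.

Local Notation free4 := {malg k[{fmonom 'I_4}]}.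

Definition i_e : 'I_4 := @Ordinal 4 0 isT.
Definition i_f : 'I_4 := @Ordinal 4 1 isT.
Definition i_h : 'I_4 := @Ordinal 4 2 isT.
Definition i_t : 'I_4 := @Ordinal 4 3 isT.

Definition gen (i : 'I_4) : free4 := << fmu i >>.

Definition relations_H : seq free4 :=
  relations (gen i_e) (gen i_f) (gen i_h) (gen i_t).

Definition ideal_H : {pred free4} :=
  fun x => `[< two_sided_ideal (fun r => r \in relations_H) x >].

Lemma ideal_HP x :
  reflect (two_sided_ideal (fun r => r \in relations_H) x) (x \in ideal_H).
Proof. exact: asboolP. Qed.

Fact ideal_H_zmod_closed : zmod_closed ideal_H.
Proof.
split; first exact/ideal_HP/Ideal0.
move=> x y /ideal_HP Ix /ideal_HP Iy; apply/ideal_HP/IdealD => //.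
by rewrite -mulN1r; apply: IdealMl.
Qed.
HB.instance Definition _ := GRing.isZmodClosed.Build _ ideal_H
  ideal_H_zmod_closed.

Lemma ideal_HMl a x : x \in ideal_H -> a * x \in ideal_H.
Proof. by move=> /ideal_HP Ix; apply/ideal_HP/IdealMl. Qed.

Lemma ideal_HMr a x : x \in ideal_H -> x * a \in ideal_H.
Proof. by move=> /ideal_HP Ix; apply/ideal_HP/IdealMr. Qed.

Lemma ideal_HZ c x : x \in ideal_H -> c *: x \in ideal_H.
Proof. by move=> Ix; rewrite -mul_malgC ideal_HMl. Qed.

Lemma ideal_H1 : 1 \notin ideal_H.
Proof.
have g0 i : mcoeff (mone : {fmonom 'I_4}) (gen i) = 0.
  by rewrite mcoeffU1 fm1_eq1.
apply/negP=> /ideal_HP /(ideal_rmorph0 (g := mcoeff (mone : {fmonom 'I_4}))).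
have gR := relations_rmorph0 (g := mcoeff (mone : {fmonom 'I_4}))
  (g0 i_e) (g0 i_f) (g0 i_h) (g0 i_t).
by move=> /(_ gR)/eqP; rewrite rmorph1 oner_eq0.
Qed.

Definition Hhat := Quotient.quot ideal_H.
HB.instance Definition _ := GRing.Zmodule.on Hhat.

End AlgebraH.

(* The operations are locked so that unification does not unfold them down to
   the multiplication of the free algebra. *)
HB.lock Definition piH (k : closedFieldType) (x : {malg k[{fmonom 'I_4}]}) :
  Hhat k := \pi_(Hhat k) x.
HB.lock Definition mulH (k : closedFieldType) (x y : Hhat k) : Hhat k :=
  piH (repr x * repr y).
HB.lock Definition scaleH (k : closedFieldType) (c : k) (x : Hhat k) : Hhat k :=
  piH (c *: repr x).

Section AlgebraHRing.

Variable k : closedFieldType.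
Local Notation free4 := {malg k[{fmonom 'I_4}]}.
Local Notation Hhat := (Hhat k).
Local Notation piH := (@piH k).
Local Notation mulH := (@mulH k).
Local Notation scaleH := (@scaleH k).
Local Notation ideal_H := (@ideal_H k).

Lemma piH_eq x y : (piH x == piH y) = (x - y \in ideal_H).
Proof. by rewrite piH.unlock piE. Qed.

Lemma piH_repr (x : Hhat) : piH (repr x) = x.
Proof. by rewrite piH.unlock reprK. Qed.

Lemma piHD : {morph piH : x y / x + y}.
Proof. by move=> x y; rewrite piH.unlock !piE. Qed.

Lemma piHM x y : mulH (piH x) (piH y) = piH (x * y).
Proof.
rewrite mulH.unlock; have reprE z : repr (piH z) - z \in ideal_H by rewrite -piH_eq piH_repr.
apply/eqP; rewrite piH_eq.
have -> : repr (piH x) * repr (piH y) - x * y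
  = (repr (piH x) - x) * repr (piH y) + x * (repr (piH y) - y).
  by rewrite mulrBl mulrBr addrA subrK.
by apply: rpredD; [apply: ideal_HMr | apply: ideal_HMl].
Qed.

Lemma piHZ c x : scaleH c (piH x) = piH (c *: x).
Proof.
by rewrite scaleH.unlock; apply/eqP; rewrite piH_eq -scalerBr ideal_HZ // -piH_eq piH_repr.
Qed.

Fact mulHA : associative mulH.
Proof.
by move=> x y z; rewrite -[x]piH_repr -[y]piH_repr -[z]piH_repr !piHM mulrA.
Qed.
Fact mul1H : left_id (piH 1) mulH.
Proof. by move=> x; rewrite -[x]piH_repr piHM mul1r. Qed.
Fact mulH1 : right_id (piH 1) mulH.
Proof. by move=> x; rewrite -[x]piH_repr piHM mulr1. Qed.
Fact mulHDl : left_distributive mulH +%R.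
Proof.
move=> x y z; rewrite -[x]piH_repr -[y]piH_repr -[z]piH_repr.
by rewrite -piHD !piHM -piHD mulrDl.
Qed.
Fact mulHDr : right_distributive mulH +%R.
Proof.
move=> x y z; rewrite -[x]piH_repr -[y]piH_repr -[z]piH_repr.
by rewrite -piHD !piHM -piHD mulrDr.
Qed.
Fact oneH_neq0 : piH 1 != 0.
Proof.
have -> : 0 = piH 0 by rewrite piH.unlock piE.
by rewrite piH_eq subr0 ideal_H1.
Qed.
HB.instance Definition _ := GRing.Zmodule_isNzRing.Build Hhat
  mulHA mul1H mulH1 mulHDl mulHDr oneH_neq0.

Fact scaleHA a b (x : Hhat) : scaleH a (scaleH b x) = scaleH (a * b) x.
Proof. by rewrite -[x]piH_repr !piHZ scalerA. Qed.
Fact scale1H : left_id 1 scaleH.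
Proof. by move=> x; rewrite -[x]piH_repr piHZ scale1r. Qed.
Fact scaleHDr : right_distributive scaleH +%R.
Proof.
move=> a x y; rewrite -[x]piH_repr -[y]piH_repr -piHD !piHZ -piHD.
by rewrite scalerDr.
Qed.
Fact scaleHDl x : {morph scaleH^~ x : a b / a + b}.
Proof. by move=> a b; rewrite -[x]piH_repr !piHZ -piHD scalerDl. Qed.
HB.instance Definition _ := GRing.Zmodule_isLmodule.Build k Hhat
  scaleHA scale1H scaleHDr scaleHDl.

Fact scaleHAl a (x y : Hhat) : a *: (x * y) = (a *: x) * y.
Proof.
change (scaleH a (mulH x y) = mulH (scaleH a x) y).
by rewrite -[x]piH_repr -[y]piH_repr !(piHM, piHZ) scalerAl.
Qed.
HB.instance Definition _ := GRing.Lmodule_isLalgebra.Build k Hhat scaleHAl.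

Fact scaleHAr a (x y : Hhat) : a *: (x * y) = x * (a *: y).
Proof.
change (scaleH a (mulH x y) = mulH x (scaleH a y)).
by rewrite -[x]piH_repr -[y]piH_repr !(piHM, piHZ) malg_scaleAr.
Qed.
HB.instance Definition _ := GRing.Lalgebra_isAlgebra.Build k Hhat scaleHAr.

Definition eH : Hhat := piH (gen k i_e).
Definition fH : Hhat := piH (gen k i_f).
Definition hH : Hhat := piH (gen k i_h).
Definition tH : Hhat := piH (gen k i_t).

End AlgebraHRing.

Section Gradings.

Variable k : closedFieldType.
Implicit Types (G : zmodType) (M N : lmodType (Hhat k)).

Definition wdeg G (w : 'I_4 -> G) (m : {fmonom 'I_4}) : G :=
  \sum_(i <- (m : seq 'I_4)) w i.

(* The relations are homogeneous for the two weights zwt and pwt below, so the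
   grading of Hhat is the image of that of the free algebra. *)
Definition Hhat_gr G (w : 'I_4 -> G) (g : G) (x : Hhat k) : Prop :=
  exists y : {malg k[{fmonom 'I_4}]},
    (forall m, m \in msupp y -> wdeg w m = g) /\ x = piH y.

Definition zwt (i : 'I_4) : int := 1.
Definition pwt (i : 'I_4) : 'Z_2 :=
  if (i == i_e) || (i == i_f) then 1 else 0.

(* The field k acts on an Hhat-module through c |-> c%:A. *)
Definition k_subspace M (P : M -> Prop) : Prop :=
  P 0 /\ forall (c : k) x y, P x -> P y -> P ((c%:A : Hhat k) *: x + y).

Definition direct_sum (I : eqType) M (W : M -> Prop) (P : I -> M -> Prop) :
    Prop :=
  [/\ forall i, k_subspace (P i),
      forall i x, P i x -> W x,
      forall x, W x -> exists (s : seq I) (y : I -> M),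
        [/\ uniq s, forall i, P i (y i) & x = \sum_(i <- s) y i]
    & forall (s : seq I) (y : I -> M),
        uniq s -> (forall i, P i (y i)) -> \sum_(i <- s) y i = 0 ->
        forall i, i \in s -> y i = 0].

Definition graded_module G (w : 'I_4 -> G) M (P : G -> M -> Prop) : Prop :=
  direct_sum (fun _ => True) P
  /\ forall i j a x, Hhat_gr w i a -> P j x -> P (i + j) (a *: x).

Definition cyclic_module M : Prop :=
  exists m : M, forall x, exists a : Hhat k, x = a *: m.

Definition has_dim M (P : M -> Prop) (d : nat) : Prop :=
  exists b : 'I_d -> M, (forall i, P (b i)) /\
    forall x, P x ->
      exists! c : {ffun 'I_d -> k}, x = \sum_i ((c i)%:A : Hhat k) *: b i.

(* The series \sum_n (c n) x^n, with no terms in negative degree. *)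
Definition hilbert_series M (P : int -> M -> Prop) (c : nat -> nat) : Prop :=
  (forall n : nat, has_dim (P n%:Z) (c n)) /\
  (forall n : int, (n < 0)%R -> forall x, P n x -> x = 0).

(* Coefficients of 1/(1 - x)^2; see line_coefE. *)
Definition line_coef (n : nat) : nat := n.+1.

Definition line_module M (MZ : int -> M -> Prop) : Prop :=
  [/\ graded_module zwt MZ, cyclic_module M & hilbert_series MZ line_coef].

Definition Z2_graded_line_module M
    (MZ : int -> M -> Prop) (MP : 'Z_2 -> M -> Prop) : Prop :=
  [/\ line_module MZ, graded_module pwt MP
    & forall n, direct_sum (MZ n) (fun p x => MZ n x /\ MP p x)].

Definition t_torsionfree M : Prop := forall x : M, tH k *: x = 0 -> x = 0.

(* The parity shift s cannot be dropped: a generator of a Z2-graded line module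
   may have either parity, while the class of 1 in line_quot is even. *)
Definition graded_isomorphic M N
    (MZ : int -> M -> Prop) (MP : 'Z_2 -> M -> Prop)
    (NZ : int -> N -> Prop) (NP : 'Z_2 -> N -> Prop) : Prop :=
  exists (g : {linear M -> N}) (s : 'Z_2),
    [/\ bijective g, forall n x, MZ n x <-> NZ n (g x)
      & forall p x, MP p x <-> NP (s + p) (g x)].

End Gradings.

Lemma line_coefE (n : nat) :
  exists r : {poly int},
    (\poly_(i < n) (line_coef i)%:R) * (1 - 'X) ^+ 2 = 1 + r * 'X^n.
Proof.
exists (- (n.+1)%:R + n%:R * 'X).
rewrite poly_def; elim: n => [|n IHn].
  by rewrite big_ord0 mul0r expr0 mulr1 mul0r addr0 subrr.
rewrite big_ord_recr /= mulrDl IHn /line_coef -mul_polyC rmorph_nat (exprS 'X).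
rewrite -!natr1; ring.
Qed.

(* MathComp has no quotient of a module by a submodule. *)
Section LmoduleQuotient.

Variables (R : pzRingType) (V : lmodType R) (S : submodClosed V).

Definition submod_pred : {pred V} := S.
Fact submod_pred_zmod_closed : zmod_closed submod_pred.
Proof.
split=> [|x y Sx Sy]; first exact: (rpred0 S).
by rewrite -scaleN1r; apply: (rpredD (S := S)) => //; apply: rpredZ.
Qed.
HB.instance Definition _ := GRing.isZmodClosed.Build V submod_pred
  submod_pred_zmod_closed.

Definition lmod_quot := Quotient.quot submod_pred.
HB.instance Definition _ := GRing.Zmodule.on lmod_quot.

Definition lmod_pi (x : V) : lmod_quot := \pi_lmod_quot x.

Lemma lmod_pi_eq x y : (lmod_pi x == lmod_pi y) = (x - y \in S).
Proof. by rewrite /lmod_pi piE. Qed.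

Lemma lmod_pi_repr (x : lmod_quot) : lmod_pi (repr x) = x.
Proof. exact: reprK. Qed.

Lemma lmod_piD : {morph lmod_pi : x y / x + y}.
Proof. by move=> x y; rewrite /lmod_pi !piE. Qed.

Definition lmod_scale (c : R) (x : lmod_quot) : lmod_quot :=
  lmod_pi (c *: repr x).

Lemma lmod_piZ c x : lmod_scale c (lmod_pi x) = lmod_pi (c *: x).
Proof.
apply/eqP; rewrite lmod_pi_eq -scalerBr; apply: (rpredZ (s := S)).
by have:= lmod_pi_eq (repr (lmod_pi x)) x; rewrite lmod_pi_repr eqxx => <-.
Qed.

Fact lmod_scaleA c d x : lmod_scale c (lmod_scale d x) = lmod_scale (c * d) x.
Proof. by rewrite -[x]lmod_pi_repr !lmod_piZ scalerA. Qed.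
Fact lmod_scale1 : left_id 1 lmod_scale.
Proof. by move=> x; rewrite -[x]lmod_pi_repr lmod_piZ scale1r. Qed.
Fact lmod_scaleDr : right_distributive lmod_scale +%R.
Proof.
move=> c x y; rewrite -[x]lmod_pi_repr -[y]lmod_pi_repr -lmod_piD !lmod_piZ.
by rewrite -lmod_piD scalerDr.
Qed.
Fact lmod_scaleDl x : {morph lmod_scale^~ x : c d / c + d}.
Proof.
by move=> c d; rewrite -[x]lmod_pi_repr !lmod_piZ -lmod_piD scalerDl.
Qed.
HB.instance Definition _ := GRing.Zmodule_isLmodule.Build R lmod_quot
  lmod_scaleA lmod_scale1 lmod_scaleDr lmod_scaleDl.

End LmoduleQuotient.

(* The sum A x + A y of two principal left ideals. *)
Section LeftIdeal.

Variables (A : nzRingType) (x y : A).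

Definition left_ideal2 : {pred A^o} :=
  fun z => `[< exists u v : A, z = u * x + v * y >].

Fact left_ideal2_submod_closed : submod_closed left_ideal2.
Proof.
split; first by apply/asboolP; exists 0, 0; rewrite !mul0r addr0.
move=> c _ _ /asboolP[u [v ->]] /asboolP[u' [v' ->]].
apply/asboolP; exists (c * u + u'), (c * v + v').
by rewrite /GRing.scale /= !mulrDr !mulrDl !mulrA addrACA.
Qed.
HB.instance Definition _ := GRing.isSubmodClosed.Build A A^o left_ideal2
  left_ideal2_submod_closed.

End LeftIdeal.

Section LineQuotient.

Variables (k : closedFieldType) (U : {vspace 'M[k]_2}).
Variables (phi : 'Hom(subvs_of U, k^o)) (a b : k).

Definition line_ideal : submodClosed (Hhat k)^o :=
  left_ideal2
    (hH k - fapp phi (h_mx k) *: tH k)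
    (a *: eH k + b *: fH k
     - fapp phi (a *: e_mx k + b *: f_mx k) *: tH k).

Definition line_quot : lmodType (Hhat k) := lmod_quot line_ideal.

Definition line_pi (x : Hhat k) : line_quot := @lmod_pi _ _ line_ideal x.

(* The grading induced by that of Hhat. *)
Definition line_quot_gr (G : zmodType) (w : 'I_4 -> G) (g : G)
    (x : line_quot) : Prop :=
  exists y, Hhat_gr w g y /\ x = line_pi y.

End LineQuotient.

(* Main.v *)
Require Import Defs.
From HB Require Import structures.
From mathcomp Require Import all_boot all_order all_algebra.
From mathcomp Require Import boolp generic_quotient ring.
From mathcomp Require Import finmap monalg.

Set Implicit Arguments.
Unset Strict Implicit.
Unset Printing Implicit Defensive.

Import GRing.Theory Num.Theory Order.TTheory.

Local Open Scope ring_scope.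

(** With [h] and [t] central, [Hhat] is a generalized Clifford algebra. Fix an
odd element [W = a e + b f], not zero, and choose [V = c e + d f] with [a d +
b c = 1] and [c d = 0]. Then [W V + V W = h t + 2 a b V^2] (anticomm_WV), and
[e], [f] are combinations of [V] and [W]. So if a vector [v] of a module
satisfies [h v = lam t v] and [W v = 0], every [W] can be pushed to the right
through powers of [V] until it kills [v], and the degree [n] part of [Hhat]
sends [v] into the span of the [n + 1] vectors [V^i t^(n - i) v]
(Hhat_spanning). The number [n + 1] is the coefficient of [x^n] in [1 / (1 -
x)^2], and both directions rest on this coincidence.

For the first direction, take for [v] the class of [1] in the quotient. The
spanning vectors are independent because [Hhat] acts on column vectors of
length two over [k[X]] in such a way that [W] kills the first basis vector
while a suitable linear form reads off [V^i] applied to it as [X^i]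
(line_model, line_basis_free). Both gradings descend from the free algebra:
the relations of [Hhat], and then [h - lam t] and [W], are homogeneous, so the
ideals they generate contain the homogeneous parts of their elements
(hpart_ideal, hpart_line_ideal).

For the converse, let [L] be a line module without [t]-torsion. Its component
[L_0] is a line; being the sum of its parity components it is spanned by a
vector [v] of definite parity (homogeneous_generator), and [v] generates [L]
(line_generator). The plane [L_1] contains [e v], [f v] of one parity and [h
v], [t v] of the other, with [t v != 0]. Three vectors of a plane are
dependent, and a dependency splits by parity. Applied to [e v], [f v], [t v]
this yields [W] with [W v = 0] (odd_relation). Applied to [e v] or [f v] with
[h v], [t v] it yields [h v = lam t v], unless [e v = f v = 0], when [t h v =
(e f + f e) v = 0] forces [h v = 0] (even_relation). Hence [L] is a quotient
of a module of the required form. As the [n + 1] spanning vectors of [L_n]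
span a space of dimension [n + 1], they are independent, so nothing more is
killed (annihilates_line_pi0). *)

(** * The presentation of the algebra *)

Lemma relations_map (A B : nzRingType) (g : {rmorphism A -> B}) (E F H T : A) :
  relations (g E) (g F) (g H) (g T) = map g (relations E F H T).
Proof. by rewrite /relations /= !(rmorphB, rmorphD, rmorphM). Qed.

Section FreeAlgebra.

Variable k : closedFieldType.
Local Notation free4 := {malg k[{fmonom 'I_4}]}.
Implicit Types (m : {fmonom 'I_4}) (x y : free4).

Lemma piH_mul x y : piH (x * y) = piH x * piH y.
Proof. exact: (esym (piHM x y)). Qed.

Lemma piH_scale c x : piH (c *: x) = c *: piH x.
Proof. exact: (esym (piHZ c x)). Qed.

Lemma piH0 : piH (0 : free4) = 0.
Proof. by apply: (addrI (piH 0)); rewrite -piHD !addr0. Qed.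

Lemma piH_sum (I : Type) (s : seq I) (F : I -> free4) :
  piH (\sum_(i <- s) F i) = \sum_(i <- s) piH (F i).
Proof. exact: (big_morph _ (@piHD k) piH0). Qed.

Lemma piH_ideal x : (piH x == 0) = (x \in @ideal_H k).
Proof. by rewrite -piH0 piH_eq subr0. Qed.

Lemma malgM_mono (c d : k) m m' :
  << c *g m >> * << d *g m' >> = << c * d *g mmul m m' >>.
Proof.
have le := msuppU_le (K := {fmonom 'I_4}).
rewrite (malgMEw (le _ _ _) (le _ _ _)).
by rewrite !big_seq_fset1 !mcoeffUU.
Qed.

Definition word (s : seq 'I_4) : Hhat k := \prod_(i <- s) piH (gen k i).

Lemma piH_mono m : piH (<< m >> : free4) = word m.
Proof.
case: m => s; rewrite /word /=; elim: s => [|i s IHs].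
  by rewrite big_nil -fmoneE.
rewrite big_cons -IHs -piH_mul /gen malgM_mono mulr1.
by congr (piH << _ *g _ >>); apply/eqP; rewrite fmP fmM fmU.
Qed.

Lemma malgU_scale (c : k) m : << c *g m >> = c *: (<< m >> : free4).
Proof.
apply/malgP => m'; rewrite [RHS]mcoeffZ [in RHS]mcoeffU [LHS]mcoeffU.
by rewrite mulrnAr mulr1.
Qed.

Lemma piHE y : piH y = \sum_(m <- msupp y) y@_m *: word m.
Proof.
rewrite {1}[y]monalgE piH_sum; apply: eq_bigr => m _.
by rewrite malgU_scale piH_scale piH_mono.
Qed.

(** The scalars have to be sent to central elements, as the relations of
[Hhat] do not mention them: they commute with the generators because [Hhat] is
an algebra over [k]. *)
Lemma Hhat_universal (S : nzRingType) (f : {rmorphism k -> S})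
    (fC : forall c z, GRing.comm (f c) z) (u : 'I_4 -> S)
    (uR : forall r : S,
       r \in relations (u i_e) (u i_f) (u i_h) (u i_t) -> r = 0) :
  exists g : {rmorphism Hhat k -> S},
    (forall c (z : Hhat k), g (c *: z) = f c * g z)
    /\ forall i, g (piH (gen k i)) = u i.
Proof.
pose h0 (m : {fmonom 'I_4}) := \prod_(i <- (m : seq 'I_4)) u i.
have h0M : mmorphism h0.
  split=> [m m'|]; rewrite /h0 ?fmM ?fm1 ?big_nil //.
  by rewrite big_cat.
pose hM := isMultiplicative.Build _ _ h0 h0M.
pose h : {mmorphism {fmonom 'I_4} -> S} := HB.pack h0 hM.
have gM := @commr_mmap_is_multiplicative _ _ _ f h (fun g m m' => fC _ _).
pose gMm := GRing.isMultiplicative.Build _ _ (mmap f h) gM.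
pose g : {rmorphism free4 -> S} := HB.pack (mmap f h) gMm.
have gU i : g (gen k i) = u i.
  rewrite [LHS](mmapU (f := f)) [X in X * _](rmorph1 f) mul1r [LHS]/= /h0.
  by rewrite fmU big_seq1.
(* The images of the relations under [g] are the relations between the [u i]. *)
have gI x : x \in @ideal_H k -> g x = 0.
  move/ideal_HP; apply: ideal_rmorph0 => r.
  by move=> /(map_f g) rR; apply: uR; rewrite -!gU relations_map.
pose gH (x : Hhat k) := g (generic_quotient.repr x).
have gHE x : gH (piH x) = g x.
  apply/eqP; rewrite -subr_eq0 -rmorphB; apply/eqP/gI.
  by rewrite -piH_eq piH_repr.
have gHa : zmod_morphism gH.
  move=> x y; rewrite -[x]piH_repr -[y]piH_repr.
  have -> : piH (generic_quotient.repr x) - piH (generic_quotient.repr y)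
    = piH (generic_quotient.repr x - generic_quotient.repr y).
    by rewrite -[in RHS]scaleN1r piHD piH_scale scaleN1r.
  by rewrite !gHE rmorphB.
have gHm : monoid_morphism gH.
  split=> [|x y]; first by rewrite gHE rmorph1.
  by rewrite -[x]piH_repr -[y]piH_repr -piH_mul !gHE rmorphM.
pose gHaM := GRing.isZmodMorphism.Build _ _ gH gHa.
pose gHmM := GRing.isMonoidMorphism.Build _ _ gH gHm.
pose G : {rmorphism Hhat k -> S} := HB.pack gH gHaM gHmM.
exists G; split=> [c x|i]; last by rewrite [LHS]gHE gU.
rewrite -[x]piH_repr -piH_scale.
rewrite [LHS]gHE [X in _ = _ * X]gHE; exact: mmapZ.
Qed.

End FreeAlgebra.

Section HhatRelations.
Variable k : closedFieldType.
Local Notation e := (eH k).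
Local Notation f := (fH k).
Local Notation h := (hH k).
Local Notation t := (tH k).

Lemma Hhat_rel i : (relations e f h t)`_i = 0.
Proof.
have pia : zmod_morphism (@piH k).
  by move=> x y; rewrite -scaleN1r piHD piH_scale scaleN1r.
have pim : monoid_morphism (@piH k) by split=> // x y; apply: piH_mul.
pose piaM := GRing.isZmodMorphism.Build _ _ (@piH k) pia.
pose pimM := GRing.isMonoidMorphism.Build _ _ (@piH k) pim.
pose p : {rmorphism {malg k[{fmonom 'I_4}]} -> Hhat k} :=
  HB.pack (@piH k) piaM pimM.
have [ilt|ige] := ltnP i 6; last by rewrite nth_default.
rewrite (relations_map p) (nth_map 0) //.
apply/eqP; rewrite [_ == _]piH_ideal; apply/ideal_HP.
by apply: IdealGen; apply: mem_nth.
Qed.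

Lemma relE_ef : e * f + f * e = h * t.
Proof. exact/subr0_eq/(Hhat_rel 0). Qed.

Lemma comm_he : GRing.comm h e.
Proof. exact/subr0_eq/(Hhat_rel 1). Qed.

Lemma comm_hf : GRing.comm h f.
Proof. exact/subr0_eq/(Hhat_rel 2). Qed.

Lemma comm_te : GRing.comm t e.
Proof. exact/esym/subr0_eq/(Hhat_rel 3). Qed.

Lemma comm_tf : GRing.comm t f.
Proof. exact/esym/subr0_eq/(Hhat_rel 4). Qed.

Lemma comm_ht : GRing.comm h t.
Proof. exact/subr0_eq/(Hhat_rel 5). Qed.

End HhatRelations.

Lemma gen_cases (P : 'I_4 -> Prop) :
  P i_e -> P i_f -> P i_h -> P i_t -> forall i, P i.
Proof.
move=> Pe Pf Ph Pt [[|[|[|[|n]]]] lt] //.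
- by rewrite (_ : Ordinal lt = i_e) //; apply: val_inj.
- by rewrite (_ : Ordinal lt = i_f) //; apply: val_inj.
- by rewrite (_ : Ordinal lt = i_h) //; apply: val_inj.
- by rewrite (_ : Ordinal lt = i_t) //; apply: val_inj.
Qed.

(** * Homogeneous parts *)

Section Homogeneous.

Variables (k : closedFieldType) (G : zmodType) (w : 'I_4 -> G).
Local Notation free4 := {malg k[{fmonom 'I_4}]}.
Implicit Types (m : {fmonom 'I_4}) (p q : free4) (x y : Hhat k) (s : seq 'I_4).

Definition homog (g : G) p := forall m, p@_m != 0 -> wdeg w m = g.

Lemma Hhat_grP g x : Hhat_gr w g x <-> exists2 p, homog g p & x = piH p.
Proof.
split=> [[p [pg ->]]|[p pg ->]]; exists p => //.
  by move=> m; rewrite mcoeff_neq0 => /pg.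
by split=> // m; rewrite -mcoeff_neq0 => /pg.
Qed.

Lemma homogD g p q : homog g p -> homog g q -> homog g (p + q).
Proof.
move=> pg qg m; have [p0|/pg//] := eqVneq p@_m 0.
by rewrite mcoeffD p0 add0r => /qg.
Qed.

Lemma homogZ g c p : homog g p -> homog g (c *: p).
Proof.
move=> pg m; rewrite [X in X != 0]mcoeffZ mulf_eq0 negb_or => /andP[_].
exact: pg.
Qed.

Lemma Hhat_gr0 g : Hhat_gr w g (0 : Hhat k).
Proof.
by apply/Hhat_grP; exists 0; rewrite ?piH0 // => m; rewrite mcoeff0 eqxx.
Qed.

Lemma Hhat_grD g x y : Hhat_gr w g x -> Hhat_gr w g y -> Hhat_gr w g (x + y).
Proof.
move=> /Hhat_grP[p pg ->] /Hhat_grP[q qg ->]; apply/Hhat_grP.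
by exists (p + q); rewrite ?piHD //; apply: homogD.
Qed.

Lemma Hhat_grZ g c x : Hhat_gr w g x -> Hhat_gr w g (c *: x).
Proof.
move=> /Hhat_grP[p pg ->]; apply/Hhat_grP.
by exists (c *: p); rewrite ?piH_scale //; apply: homogZ.
Qed.

Lemma Hhat_gr_word s : Hhat_gr w (\sum_(i <- s) w i) (word k s).
Proof.
apply/Hhat_grP; exists << FMonom s >>; last by rewrite piH_mono.
by move=> m; rewrite mcoeffU1; case: (FMonom s =P m) => [<-//|_]; rewrite eqxx.
Qed.

(** A homogeneous element is a combination of words of its own weight, so
statements about the components of [Hhat] need only be checked on words. *)
Lemma Hhat_gr_ind g (P : Hhat k -> Prop) :
  P 0 -> (forall x y, P x -> P y -> P (x + y)) ->
  (forall c x, P x -> P (c *: x)) ->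
  (forall s, \sum_(i <- s) w i = g -> P (word k s)) ->
  forall x, Hhat_gr w g x -> P x.
Proof.
move=> P0 PD PZ Pw x [p [pg ->]]; rewrite piHE big_seq.
elim/big_ind: _ => // m /pg mg; apply: PZ; exact: Pw.
Qed.

Lemma word_cat s s' : word k (s ++ s') = word k s * word k s'.
Proof. by rewrite /word big_cat. Qed.

Lemma Hhat_grM g h x y :
  Hhat_gr w g x -> Hhat_gr w h y -> Hhat_gr w (g + h) (x * y).
Proof.
move=> xg yh; elim/Hhat_gr_ind: x / xg => [|x x' IHx IHx'|c x IHx|s sg].
- by rewrite mul0r; apply: Hhat_gr0.
- by rewrite mulrDl; apply: Hhat_grD.
- by rewrite -scalerAl; apply: Hhat_grZ.
elim/Hhat_gr_ind: y / yh => [|y y' IHy IHy'|c y IHy|s' s'h].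
- by rewrite mulr0; apply: Hhat_gr0.
- by rewrite mulrDr; apply: Hhat_grD.
- by rewrite -scalerAr; apply: Hhat_grZ.
by rewrite -word_cat -sg -s'h -big_cat; apply: Hhat_gr_word.
Qed.

Lemma Hhat_gr1 : Hhat_gr w 0 (1 : Hhat k).
Proof. by have := Hhat_gr_word [::]; rewrite /word !big_nil. Qed.

Lemma Hhat_gr_gen i : Hhat_gr w (w i) (piH (gen k i)).
Proof. by have := Hhat_gr_word [:: i]; rewrite /word !big_seq1. Qed.

Lemma Hhat_grX g x n : Hhat_gr w g x -> Hhat_gr w (g *+ n) (x ^+ n).
Proof.
move=> xg; elim: n => [|n IHn]; first by rewrite mulr0n expr0; apply: Hhat_gr1.
by rewrite mulrS exprS; apply: Hhat_grM.
Qed.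

(** The component of weight [g] is taken in the free algebra, where it can be
read off the coefficients; on quotients it is only available afterwards, once
the ideals are known to be stable. *)
Definition hpart (g : G) p : free4 :=
  [malg m in msupp p => if wdeg w m == g then p@_m else 0].

Lemma hpartE g p m : (hpart g p)@_m = if wdeg w m == g then p@_m else 0.
Proof.
rewrite /hpart mcoeffE; case: ifPn => // mp.
by rewrite (mcoeff_outdom mp) if_same.
Qed.

Lemma hpartD g p q : hpart g (p + q) = hpart g p + hpart g q.
Proof.
apply/malgP=> m; rewrite mcoeffD !hpartE mcoeffD; case: ifP => // _.
by rewrite addr0.
Qed.

Lemma hpart0 g : hpart g 0 = 0.
Proof. by apply/malgP=> m; rewrite hpartE mcoeff0 if_same. Qed.

Lemma hpart_sum g (I : Type) (r : seq I) (F : I -> free4) :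
  hpart g (\sum_(i <- r) F i) = \sum_(i <- r) hpart g (F i).
Proof. exact: (big_morph _ (hpartD g) (hpart0 g)). Qed.

Lemma hpart_mono g c m :
  hpart g << c *g m >> = << if wdeg w m == g then c else 0 *g m >>.
Proof.
apply/malgP=> m'; rewrite hpartE [RHS]mcoeffU [in LHS]mcoeffU.
by case: (m =P m') => [->//|_]; rewrite mulr0n if_same.
Qed.

Lemma hpart_homog g p : homog g (hpart g p).
Proof.
by move=> m; rewrite hpartE; case: (wdeg w m =P g) => // _; rewrite eqxx.
Qed.

Lemma hpart_id g p : homog g p -> hpart g p = p.
Proof.
move=> pg; apply/malgP=> m; rewrite hpartE; case: (wdeg w m =P g) => // neq.
by case: (eqVneq p@_m 0) => // /pg.
Qed.

Lemma hpart_neq g h p : homog g p -> g != h -> hpart h p = 0.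
Proof.
move=> pg gh; apply/malgP=> m; rewrite hpartE mcoeff0.
case: (wdeg w m =P h) => // mh.
by case: (eqVneq p@_m 0) => // /pg mg; rewrite -mh mg eqxx in gh.
Qed.

Lemma hpart_supp_sum p :
  p = \sum_(g <- undup [seq wdeg w m | m <- msupp p]) hpart g p.
Proof.
set s := undup _.
apply/malgP=> m; rewrite raddf_sum /=.
under eq_bigr do rewrite hpartE.
have [mp|mp] := boolP (m \in msupp p); last first.
  by rewrite (mcoeff_outdom mp) big1 // => g _; rewrite if_same.
have ms : wdeg w m \in s by rewrite mem_undup map_f.
rewrite (bigD1_seq _ ms (undup_uniq _)) /= eqxx big1 ?addr0 // => g.
by rewrite eq_sym => /negbTE->.
Qed.

Lemma wdegM m m' : wdeg w (mmul m m') = wdeg w m + wdeg w m'.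
Proof. by rewrite /wdeg fmM big_cat. Qed.

Lemma hpart_supp g p : (msupp (hpart g p) `<=` msupp p)%fset.
Proof.
apply/fsubsetP=> m; rewrite -!mcoeff_neq0 hpartE.
by case: ifP => //; rewrite eqxx.
Qed.

(** A homogeneous factor only shifts the weights. Applied to monomials, and to
the generators of an ideal, this is what makes ideals stable under taking
components. *)
Lemma hpartMr g h p q : homog h q -> hpart g (p * q) = hpart (g - h) p * q.
Proof.
move=> qh; rewrite (malgMEw (fsubset_refl (msupp p)) (fsubset_refl (msupp q))).
rewrite (malgMEw (hpart_supp (g - h) p) (fsubset_refl (msupp q))).
rewrite hpart_sum; apply: eq_bigr => m _; rewrite hpart_sum.
rewrite big_seq [RHS]big_seq; apply: eq_bigr => m'.
rewrite -mcoeff_neq0 => /qh mh; rewrite hpart_mono wdegM mh hpartE.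
have -> : (wdeg w m + h == g) = (wdeg w m == g - h).
  by rewrite [RHS]eq_sym subr_eq eq_sym.
by case: (wdeg w m == g - h); [|rewrite [X in _ = << X *g _ >>]mul0r].
Qed.

Lemma hpartMl g h p q : homog h q -> hpart g (q * p) = q * hpart (g - h) p.
Proof.
move=> qh; rewrite (malgMEw (fsubset_refl (msupp q)) (fsubset_refl (msupp p))).
rewrite (malgMEw (fsubset_refl (msupp q)) (hpart_supp (g - h) p)).
rewrite hpart_sum big_seq [RHS]big_seq; apply: eq_bigr => m'.
rewrite -mcoeff_neq0 => /qh mh; rewrite hpart_sum; apply: eq_bigr => m _.
rewrite hpart_mono wdegM mh hpartE.
have -> : (h + wdeg w m == g) = (wdeg w m == g - h).
  by rewrite [RHS]eq_sym subr_eq eq_sym addrC.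
by case: (wdeg w m == g - h); [|rewrite [X in _ = << X *g _ >>]mulr0].
Qed.

End Homogeneous.

Lemma sum_zwt (s : seq 'I_4) : \sum_(i <- s) zwt i = (size s)%:Z.
Proof. by elim: s => [|i s IHs]; rewrite ?big_nil ?big_cons // IHs -intS. Qed.

(** The summands outside of [s] are required to vanish so that [y g] can be
used for any [g] as the component of weight [g]. *)
Lemma Hhat_decomp (k : closedFieldType) (G : zmodType) (w : 'I_4 -> G)
    (x : Hhat k) :
  exists (s : seq G) (y : G -> Hhat k),
    [/\ uniq s, forall g, Hhat_gr w g (y g), forall g, g \notin s -> y g = 0
      & x = \sum_(g <- s) y g].
Proof.
rewrite -[x]piH_repr; set p := generic_quotient.repr x.
exists (undup [seq wdeg w m | m <- msupp p]), (fun g => piH (hpart w g p)).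
split=> [|g|g gs|]; first exact: undup_uniq.
- by apply/Hhat_grP; exists (hpart w g p) => //; apply: hpart_homog.
- have -> : hpart w g p = 0; last by rewrite piH0.
  apply/malgP=> m; rewrite hpartE mcoeff0.
  case: (wdeg w m =P g) => // mg; apply/eqP; apply: contraNT gs.
  by rewrite mcoeff_neq0 mem_undup -mg => ?; apply: map_f.
by rewrite {1}[p](hpart_supp_sum w) piH_sum.
Qed.

Lemma Hhat_gr_neg (k : closedFieldType) (n : int) (x : Hhat k) :
  n < 0 -> Hhat_gr zwt n x -> x = 0.
Proof.
move=> n0 /Hhat_grP[p pn ->].
have -> : p = 0; last by rewrite piH0.
apply/malgP=> m; rewrite mcoeff0; apply/eqP; apply: contraLR n0 => /pn.
by rewrite /wdeg sum_zwt => <-.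
Qed.

(** Every generator has degree one, so the only word of degree zero is the
empty one. *)
Lemma Hhat_gr_zero (k : closedFieldType) (x : Hhat k) :
  Hhat_gr zwt 0 x -> exists z : k, x = z%:A.
Proof.
elim/Hhat_gr_ind => {x} [|x y [z ->] [z' ->]|u x [z ->]|[|i s]].
- by exists 0; rewrite scale0r.
- by exists (z + z'); rewrite scalerDl.
- by exists (u * z); rewrite scalerA.
- by exists 1; rewrite /word big_nil scale1r.
- by rewrite sum_zwt.
Qed.

Lemma Hhat_gr_basis (k : closedFieldType) (c d : k) n i : (i <= n)%N ->
  Hhat_gr zwt n%:Z ((c *: eH k + d *: fH k) ^+ i * tH k ^+ (n - i)).
Proof.
move=> lein; have -> : n%:Z = 1 *+ i + 1 *+ (n - i).
  by rewrite -mulrnDr subnKC // natz.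
apply: Hhat_grM; apply: Hhat_grX; last exact: (Hhat_gr_gen k zwt i_t).
by apply: Hhat_grD; apply: Hhat_grZ; [apply: (Hhat_gr_gen k zwt i_e)|
  apply: (Hhat_gr_gen k zwt i_f)].
Qed.

(** * Gradings of the quotient by a homogeneous left ideal *)

Section LineQuotientTheory.

Variables (k : closedFieldType) (U : {vspace 'M[k]_2}).
Variables (phi : 'Hom(subvs_of U, k^o)) (a b : k).
Local Notation N := (line_quot phi a b).
Local Notation pi := (line_pi phi a b).

Lemma line_piD : {morph pi : x y / x + y}.
Proof. by move=> x y; exact: (@lmod_piD _ _ (line_ideal phi a b) x y). Qed.

Lemma line_piM u x : pi (u * x) = u *: pi x.
Proof. exact: (esym (@lmod_piZ _ _ (line_ideal phi a b) u x)). Qed.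

Lemma line_piE x : pi x = x *: pi 1.
Proof. by rewrite -line_piM mulr1. Qed.

Lemma line_pi0 : pi 0 = 0.
Proof. by rewrite line_piE scale0r. Qed.

Lemma line_pi_sum (I : Type) (s : seq I) (F : I -> Hhat k) :
  pi (\sum_(i <- s) F i) = \sum_(i <- s) pi (F i).
Proof. exact: (big_morph _ line_piD line_pi0). Qed.

Lemma line_pi_surj (x : N) : exists y, x = pi y.
Proof. by exists (generic_quotient.repr x); rewrite /line_pi lmod_pi_repr. Qed.

Lemma line_pi_eq0 x : pi x = 0 <-> exists u v,
  x = u * (hH k - fapp phi (h_mx k) *: tH k)
    + v * (a *: eH k + b *: fH k
           - fapp phi (a *: e_mx k + b *: f_mx k) *: tH k).
Proof.
rewrite -line_pi0; split.
  by move/eqP; rewrite lmod_pi_eq subr0 => /asboolP.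
by move=> E; apply/eqP; rewrite lmod_pi_eq subr0; apply/asboolP.
Qed.

End LineQuotientTheory.

Section RelationWeights.

Variables (k : closedFieldType) (G : zmodType) (w : 'I_4 -> G).
Hypothesis w_efht : w i_e + w i_f = w i_h + w i_t.
Local Notation free4 := {malg k[{fmonom 'I_4}]}.

Lemma homog_genM i j : homog w (w i + w j) (gen k i * gen k j).
Proof.
rewrite /gen malgM_mono mulr1 => m; rewrite mcoeffU1.
case: (_ =P m) => [<- _|_]; last by rewrite eqxx.
by rewrite wdegM /wdeg !fmU !big_seq1.
Qed.

Lemma homogB g (p q : free4) : homog w g p -> homog w g q -> homog w g (p - q).
Proof. by move=> pg qg; rewrite -scaleN1r; apply/homogD/homogZ. Qed.

Lemma hpartB g (p q : free4) : hpart w g (p - q) = hpart w g p - hpart w g q.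
Proof.
apply/malgP=> m; rewrite mcoeffB !hpartE mcoeffB; case: ifP => // _.
by rewrite subr0.
Qed.

(** The assumption on [w] is what makes [e f + f e - h t] homogeneous; the
other five relations are commutators, homogeneous for any weight. *)
Lemma relations_homog r : r \in relations_H k -> exists g, homog w g r.
Proof.
have sw i j : homog w (w i + w j) (gen k j * gen k i).
  by rewrite addrC; apply: homog_genM.
have comm i j : homog w (w i + w j) (gen k i * gen k j - gen k j * gen k i).
  by apply: homogB; [apply: homog_genM|apply: sw].
rewrite !inE; case/or4P => [/eqP->|/eqP->|/eqP->|/or3P[]/eqP->].
- exists (w i_h + w i_t); apply: homogB; last exact: homog_genM.
  by rewrite -w_efht; apply: homogD; [apply: homog_genM|apply: sw].
- by exists (w i_h + w i_e); apply: comm.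
- by exists (w i_h + w i_f); apply: comm.
- by exists (w i_e + w i_t); apply: comm.
- by exists (w i_f + w i_t); apply: comm.
- by exists (w i_h + w i_t); apply: comm.
Qed.

(** Induction on the generation of the ideal; an arbitrary factor is first
split into monomials, which are homogeneous. *)
Lemma hpart_ideal g p : p \in @ideal_H k -> hpart w g p \in @ideal_H k.
Proof.
move=> /ideal_HP pI; elim: pI g => [|r rR|q r _ + _|q r _|q r _].
- by move=> g; rewrite hpart0 rpred0.
- have [h rh] := relations_homog rR.
  move=> g; have [<-|hg] := eqVneq h g.
    by rewrite (hpart_id rh); apply/ideal_HP; apply: IdealGen.
  by rewrite (hpart_neq rh hg) rpred0.
- by move=> qI rI g; rewrite hpartD; apply: rpredD (qI g) (rI g).
- move=> rI g; rewrite [q]monalgE mulr_suml hpart_sum.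
  apply: rpred_sum => m _; rewrite (@hpartMl _ _ _ _ (wdeg w m)).
    exact: ideal_HMl.
  by move=> m'; rewrite mcoeffU; case: (m =P m') => [->//|_]; rewrite eqxx.
- move=> rI g; rewrite [q]monalgE mulr_sumr hpart_sum.
  apply: rpred_sum => m _; rewrite (@hpartMr _ _ _ _ (wdeg w m)).
    exact: ideal_HMr.
  by move=> m'; rewrite mcoeffU; case: (m =P m') => [->//|_]; rewrite eqxx.
Qed.

Hypotheses (w_ht : w i_h = w i_t) (w_ef : w i_e = w i_f).
Variables (U : {vspace 'M[k]_2}) (phi : 'Hom(subvs_of U, k^o)) (a b : k).
Hypothesis phi0 : fapp phi (a *: e_mx k + b *: f_mx k) = 0.
Local Notation pi := (line_pi phi a b).

(** With [phi] graded, the second generator of the left ideal loses its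
[t]-term and becomes homogeneous, of the common weight of [e] and [f]; the
first one is homogeneous because [h] and [t] have the same weight. *)
Lemma hpart_line_ideal g p : pi (piH p) = 0 -> pi (piH (hpart w g p)) = 0.
Proof.
pose R1 := gen k i_h - fapp phi (h_mx k) *: gen k i_t.
pose R2 := a *: gen k i_e + b *: gen k i_f.
have gen1 i : homog w (w i) (gen k i).
  move=> m; rewrite mcoeffU1; case: (_ =P m) => [<- _|_]; last by rewrite eqxx.
  by rewrite /wdeg fmU big_seq1.
have R1h : homog w (w i_h) R1.
  by apply: homogB; [|rewrite w_ht; apply: homogZ]; apply: gen1.
have R2h : homog w (w i_e) R2.
  by apply: homogD; [|rewrite w_ef]; apply: homogZ; apply: gen1.
have R1E : piH R1 = hH k - fapp phi (h_mx k) *: tH k.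
  by rewrite /R1 -scaleNr piHD piH_scale scaleNr.
have R2E : piH R2 = a *: eH k + b *: fH k
           - fapp phi (a *: e_mx k + b *: f_mx k) *: tH k.
  rewrite phi0 [X in _ = _ - X]scale0r [RHS]subr0 /R2 piHD.
  by congr (_ + _); apply: piH_scale.
move/line_pi_eq0 => [u [v]]; rewrite -R1E -R2E -[u]piH_repr -[v]piH_repr.
set p1 := generic_quotient.repr u; set p2 := generic_quotient.repr v.
rewrite -!piH_mul -piHD => /eqP; rewrite piH_eq => /(hpart_ideal g).
pose g1 := g - w i_h; pose g2 := g - w i_e.
have E : hpart w g (p1 * R1 + p2 * R2)
    = hpart w g1 p1 * R1 + hpart w g2 p2 * R2.
  by rewrite hpartD; congr (_ + _); apply: hpartMr.
rewrite hpartB [X in _ - X]E -piH_eq [X in _ == X]piHD.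
move/eqP=> ->; apply/line_pi_eq0; rewrite -R1E -R2E.
rewrite [X in X + _]piH_mul [X in _ + X]piH_mul.
by do 2!eexists.
Qed.

(** A vanishing sum of homogeneous classes lifts to an element of the left
ideal, and the components of that element are the lifts of the summands. *)
Lemma line_quot_gr_indep (s : seq G) (y : G -> line_quot phi a b) :
  uniq s -> (forall g, line_quot_gr w g (y g)) -> \sum_(g <- s) y g = 0 ->
  forall g, g \in s -> y g = 0.
Proof.
move=> s_uniq yP sum0 g gs.
have /choice[p pP] g' : exists p : free4, homog w g' p /\ y g' = pi (piH p).
  have [_ [/Hhat_grP[p pg ->] ->]] := yP g'; by exists p.
have piS : pi (piH (\sum_(g' <- s) p g')) = 0.
  rewrite piH_sum line_pi_sum.
  by rewrite -(eq_bigr _ (fun g' _ => proj2 (pP g'))).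
have := hpart_line_ideal g piS; rewrite hpart_sum (bigD1_seq _ gs s_uniq) /=.
rewrite big1 => [|g' neq]; last by apply: hpart_neq neq; have [] := pP g'.
have [pg yE] := pP g.
by rewrite addr0 (hpart_id pg) yE.
Qed.

End RelationWeights.

(** * Spanning vectors of a cyclic module with two linear relations *)

(** The condition [a d + b c = 1] normalizes the coefficient of [e f + f e] in
[W V + V W]. With [c d = 0], the element [V] is a multiple of [e] or of [f],
and then the square of [a d - b c] is one, so [V] and [W] are independent. *)
Lemma polar_companion (k : fieldType) (a b : k) : (a, b) != (0, 0) ->
  exists c d, a * d + b * c = 1 /\ c * d = 0.
Proof.
have [->|a0] := eqVneq a 0; have [->|b0] := eqVneq b 0; rewrite ?eqxx // => _.
- by exists b^-1, 0; rewrite mulr0 mulr0 add0r mulfV.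
- by exists 0, a^-1; rewrite !mul0r mulfV // addr0.
- by exists 0, a^-1; rewrite mulr0 mul0r mulfV // addr0.
Qed.

Section Spanning.

Variables (k : fieldType) (A : algType k) (e f h t : A).
Hypotheses (ef_ht : e * f + f * e = h * t).
Hypotheses (he : GRing.comm h e) (hf : GRing.comm h f) (ht : GRing.comm h t).
Hypotheses (te : GRing.comm t e) (tf : GRing.comm t f).
Variables (a b c d lam : k).
Hypotheses (adbc : a * d + b * c = 1) (cd0 : c * d = 0).
Local Notation W := (a *: e + b *: f).
Local Notation V := (c *: e + d *: f).

Lemma commrZ (x y : A) (z : k) : GRing.comm x y -> GRing.comm x (z *: y).
Proof. by move=> xy; rewrite /GRing.comm -scalerAr xy scalerAl. Qed.

(** The left side is [2 a c e^2 + 2 b d f^2 + (a d + b c) (e f + f e)], while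
[V^2] is [c^2 e^2 + d^2 f^2]; the coefficients agree because [a b c^2 = a c]
and [a b d^2 = b d]. *)
Lemma anticomm_WV : W * V + V * W = h * t + (a * b *+ 2) *: (V * V).
Proof.
rewrite -ef_ht !mulrDl !mulrDr -!scalerAl -!scalerAr !scalerA.
rewrite [LHS]addrACA [X in X + _ = _]addrACA [X in _ + X = _]addrACA.
rewrite -!scalerDl.
rewrite [d * c]mulrC cd0 !scale0r addr0 add0r scalerDr !scalerA.
rewrite [RHS]addrACA [e * f + _]addrC.
have -> : a * d + c * b = 1 by rewrite [c * b]mulrC.
have -> : b * c + d * a = 1 by rewrite [d * a]mulrC addrC.
rewrite !scale1r; congr (_ *: _ + _ + (_ + _ *: _)).
  (* Both sides agree modulo [a d + b c = 1] and [c d = 0]. *)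
  transitivity ((a * c *+ 2) * (a * d + b * c) - a * a * (c * d) *+ 2).
    by rewrite adbc cd0; ring.
  by ring.
transitivity ((b * d *+ 2) * (a * d + b * c) - b * b * (c * d) *+ 2).
  by rewrite adbc cd0; ring.
by ring.
Qed.

Lemma comm_tV : GRing.comm t V.
Proof. by apply: commrD; apply: commrZ. Qed.

Lemma comm_tW : GRing.comm t W.
Proof. by apply: commrD; apply: commrZ. Qed.

Lemma comm_hV : GRing.comm h V.
Proof. by apply: commrD; apply: commrZ. Qed.

Variables (M : lmodType A) (v : M).
Hypotheses (hv : h *: v = (lam *: t) *: v) (Wv : W *: v = 0).

Definition in_span n (x : M) := exists z : nat -> k,
  x = \sum_(i < n.+1) (z i *: (V ^+ i * t ^+ (n - i))) *: v.

Lemma in_span0 n : in_span n 0.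
Proof. by exists (fun=> 0); rewrite big1 // => i _; rewrite !scale0r. Qed.

Lemma in_spanD n x y : in_span n x -> in_span n y -> in_span n (x + y).
Proof.
move=> [z ->] [z' ->]; exists (fun i => z i + z' i).
by rewrite -big_split; apply: eq_bigr => i _; rewrite /= scalerDl scalerDl.
Qed.

(** A scalar of [k] acts on an [A]-module only through [u%:A]; this moves it
into the algebra. *)
Lemma alg_scale (u : k) (y : A) (x : M) :
  (u%:A : A) *: (y *: x) = (u *: y) *: x.
Proof. by rewrite scalerA mulr_algl. Qed.

Lemma in_spanZ n u x : in_span n x -> in_span n ((u%:A : A) *: x).
Proof.
move=> [z ->]; exists (fun i => u * z i).
by rewrite scaler_sumr; apply: eq_bigr => i _; rewrite alg_scale scalerA.
Qed.

Lemma in_span_basis i j : in_span (i + j) ((V ^+ i * t ^+ j) *: v).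
Proof.
have lei : (i < (i + j).+1)%N by rewrite ltnS leq_addr.
exists (fun l => (l == i)%:R); rewrite (bigD1 (Ordinal lei)) //= big1.
  by rewrite addr0 eqxx scale1r addKn.
by move=> l; rewrite -val_eqE /= => /negbTE->; rewrite !scale0r.
Qed.

(** Once the four generators have this property, it propagates along words. *)
Definition raises u := forall n x, in_span n x -> in_span n.+1 (u *: x).

Lemma raises_basis u :
  (forall i j, in_span (i + j).+1 (u *: ((V ^+ i * t ^+ j) *: v))) -> raises u.
Proof.
move=> uB n x [z ->]; rewrite scaler_sumr.
elim/big_ind: _ => [||[i lei] _]; [exact: in_span0|exact: in_spanD|].
rewrite scalerA -scalerAr -alg_scale -scalerA; apply: in_spanZ.
by have := uB i (n - i)%N; rewrite subnKC.
Qed.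

Lemma raisesD u u' : raises u -> raises u' -> raises (u + u').
Proof. by move=> ru ru' n x xn; rewrite scalerDl; apply: in_spanD; auto. Qed.

Lemma raisesZ z u : raises u -> raises (z *: u).
Proof. by move=> ru n x xn; rewrite -alg_scale; apply: in_spanZ; auto. Qed.

Lemma raises_V : raises V.
Proof.
apply: raises_basis => i j; rewrite scalerA mulrA -exprS -addSn.
exact: in_span_basis.
Qed.

Lemma raises_t : raises t.
Proof.
apply: raises_basis => i j; rewrite scalerA mulrA.
have -> : t * V ^+ i = V ^+ i * t.
  exact/commrX/comm_tV.
by rewrite -mulrA -exprS -addnS; apply: in_span_basis.
Qed.

Lemma h_act_basis i j :
  h *: ((V ^+ i * t ^+ j) *: v) = (lam *: (V ^+ i * t ^+ j.+1)) *: v.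
Proof.
rewrite scalerA.
have -> : h * (V ^+ i * t ^+ j) = V ^+ i * t ^+ j * h.
  by apply: commrM; apply: commrX => //; apply: comm_hV.
by rewrite -scalerA hv scalerA -scalerAr -mulrA -exprSr.
Qed.

Lemma raises_h : raises h.
Proof.
apply: raises_basis => i j; rewrite h_act_basis -alg_scale; apply: in_spanZ.
by rewrite -addnS; apply: in_span_basis.
Qed.

(** On [V^i t^j v], move [W] past one [V] at a time: each step leaves the
terms [h t] and [2 a b V^2] applied to a shorter power, and at [i = 0] what
remains is [t^j W v = 0]. *)
Lemma raises_W : raises W.
Proof.
apply: raises_basis => i j; elim: i => [|i IHi].
  rewrite expr0 mul1r scalerA.
  have -> : W * t ^+ j = t ^+ j * W.
    exact/commrX/commr_sym/comm_tW.
  by rewrite -scalerA Wv scaler0; apply: in_span0.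
rewrite exprS -mulrA -scalerA [W *: _]scalerA.
have -> : W * V = (h * t + (a * b *+ 2) *: (V * V)) - V * W.
  by rewrite -anticomm_WV addrK.
rewrite scalerBl scalerDl -[X in _ - X]scale1r -scaleNr.
have -> : (-1 : A) = (-1 : k)%:A by rewrite scaleN1r.
apply: in_spanD; [apply: in_spanD|apply: in_spanZ].
- rewrite -[(h * t) *: _]scalerA; apply: raises_h; rewrite addSn.
  exact/raises_t/in_span_basis.
- rewrite -alg_scale; apply: in_spanZ; rewrite -[(V * V) *: _]scalerA.
  apply: raises_V.
  by rewrite addSn; apply: raises_V; apply: in_span_basis.
- by rewrite -[(V * W) *: _]scalerA; apply: raises_V; rewrite addSn; apply: IHi.
Qed.

(** [(a d - b c)^2 = (a d + b c)^2 - 4 a b c d]. *)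
Lemma delta2 : (a * d - b * c) * (a * d - b * c) = 1.
Proof.
transitivity ((a * d + b * c) ^+ 2 - a * b * (c * d) *+ 4); first by ring.
by rewrite adbc cd0; ring.
Qed.

Lemma eE : e = (a * d - b * c) *: (d *: W + (- b) *: V).
Proof.
rewrite !scalerDr !scalerA addrACA -!scalerDl.
have -> : (a * d - b * c) * d * a + (a * d - b * c) * - b * c = 1.
  by rewrite -delta2; ring.
have -> : (a * d - b * c) * d * b + (a * d - b * c) * - b * d = 0 by ring.
by rewrite scale1r scale0r addr0.
Qed.

Lemma fE : f = (a * d - b * c) *: ((- c) *: W + a *: V).
Proof.
rewrite !scalerDr !scalerA addrACA -!scalerDl.
have -> : (a * d - b * c) * - c * a + (a * d - b * c) * a * c = 0 by ring.
have -> : (a * d - b * c) * - c * b + (a * d - b * c) * a * d = 1.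
  by rewrite -delta2; ring.
by rewrite scale1r scale0r add0r.
Qed.

Lemma raises_e : raises e.
Proof.
rewrite eE; apply/raisesZ/raisesD; apply: raisesZ; first exact: raises_W.
exact: raises_V.
Qed.

Lemma raises_f : raises f.
Proof.
rewrite fE; apply/raisesZ/raisesD; apply: raisesZ; first exact: raises_W.
exact: raises_V.
Qed.

End Spanning.

Section HhatSpanning.
Variables (k : closedFieldType) (a b c d lam : k).
Hypotheses (adbc : a * d + b * c = 1) (cd0 : c * d = 0).
Local Notation W := (a *: eH k + b *: fH k).
Local Notation V := (c *: eH k + d *: fH k).
Variables (M : lmodType (Hhat k)) (v : M).
Hypotheses (hv : hH k *: v = (lam *: tH k) *: v) (Wv : W *: v = 0).

(** This bounds the dimension of the degree [n] part of [Hhat v] by [n + 1],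
for the universal module [L_(h, phi)] and for the modules to be classified
alike. *)
Lemma Hhat_spanning n x : Hhat_gr zwt n%:Z x ->
  in_span (eH k) (fH k) (tH k) c d v n (x *: v).
Proof.
elim/Hhat_gr_ind => {x} [|x y xn yn|u x xn|s].
- by rewrite scale0r; apply: in_span0.
- by rewrite scalerDl; apply: in_spanD.
- by rewrite -alg_scale; apply: in_spanZ.
rewrite sum_zwt => -[<-] {n}; elim: s => [|i s IHs].
  rewrite /word big_nil.
  by have := in_span_basis (eH k) (fH k) (tH k) c d v 0 0; rewrite !expr0 mulr1.
rewrite /word big_cons -scalerA.
have /(_ i) raises_gen :
    forall i, raises (eH k) (fH k) (tH k) c d v (piH (gen k i)).
  apply: gen_cases.
  - exact: (raises_e (relE_ef k) (comm_he k) (comm_hf k) (comm_ht k)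
     (comm_te k) (comm_tf k) adbc cd0 hv Wv).
  - exact: (raises_f (relE_ef k) (comm_he k) (comm_hf k) (comm_ht k)
     (comm_te k) (comm_tf k) adbc cd0 hv Wv).
  - exact: (raises_h (comm_he k) (comm_hf k) (comm_ht k) hv).
  - exact: (raises_t (comm_te k) (comm_tf k)).
exact: raises_gen.
Qed.

End HhatSpanning.

(** * Independence of the spanning vectors *)

Section Model.

Variables (k : closedFieldType) (a b c d lam : k).
Hypotheses (adbc : a * d + b * c = 1) (cd0 : c * d = 0).
Local Notation W := (a *: eH k + b *: fH k).
Local Notation V := (c *: eH k + d *: fH k).

(** Matrices given by their four entries, so that an identity between matrices
of the model reduces to four identities between polynomials. *)
Definition mx2 (R : nzRingType) (x y z t : R) : 'M[R]_2 :=
  \matrix_(i, j) if i == 0 then (if j == 0 then x else y)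
                 else (if j == 0 then z else t).

Lemma mx2M (R : nzRingType) (x y z t x' y' z' t' : R) :
  mx2 x y z t *m mx2 x' y' z' t'
  = mx2 (x * x' + y * z') (x * y' + y * t') (z * x' + t * z') (z * y' + t * t').
Proof.
apply/matrixP=> i j; rewrite !mxE !big_ord_recl big_ord0 !mxE addr0 /=.
by case: (i == 0); case: (j == 0).
Qed.

Lemma mx2D (R : nzRingType) (x y z t x' y' z' t' : R) :
  mx2 x y z t + mx2 x' y' z' t' = mx2 (x + x') (y + y') (z + z') (t + t').
Proof.
by apply/matrixP=> i j; rewrite !mxE; case: (i == 0); case: (j == 0).
Qed.

Lemma mx2B (R : nzRingType) (x y z t x' y' z' t' : R) :
  mx2 x y z t - mx2 x' y' z' t' = mx2 (x - x') (y - y') (z - z') (t - t').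
Proof.
by apply/matrixP=> i j; rewrite !mxE; case: (i == 0); case: (j == 0).
Qed.

Lemma mx2E (R : nzRingType) (x : R) : x%:M = mx2 x 0 0 x.
Proof.
apply/matrixP=> i j; rewrite !mxE.
by case: i => [[|[|]]] // ?; case: j => [[|[|]]] // ?.
Qed.

(** On columns of length two over [k[X]], the element [t] acts as one and [h]
as [lam]: setting [t = 1] loses nothing inside one degree. The first basis
vector plays the role of [v], the second that of [V v], and [V^2] acts as the
scalar [X^2]. *)
Definition model_V : 'M[{poly k}]_2 := mx2 0 ('X ^+ 2) 1 0.

(** [W] kills the first basis vector and sends the second one to [(W V + V W)
v], that is [lam + 2 a b X^2] times the first. *)
Definition model_W : 'M[{poly k}]_2 :=
  mx2 0 (lam%:P + (a * b *+ 2)%:P * 'X ^+ 2) 0 0.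

Definition scalar_polyC (u : k) : 'M[{poly k}]_2 := (u%:P)%:M.

(** The expressions of [e] and [f] through [V] and [W], as in [eE] and [fE]. *)
Definition model_e := scalar_polyC (a * d - b * c)
  * (scalar_polyC d * model_W - scalar_polyC b * model_V).

Definition model_f := scalar_polyC (a * d - b * c)
  * (scalar_polyC a * model_V - scalar_polyC c * model_W).

Lemma line_model : exists g : {rmorphism Hhat k -> 'M[{poly k}]_2},
  [/\ forall z x, g (z *: x) = scalar_polyC z * g x,
      g (hH k) = scalar_polyC lam, g (tH k) = 1, g W = model_W & g V = model_V].
Proof.
have scalar_polyC_comm z (x : 'M[{poly k}]_2) : GRing.comm (scalar_polyC z) x.
  exact: (esym (scalar_mxC _ _)).
pose dlt := a * d - b * c.
pose u (i : 'I_4) := if i == i_e then model_e else if i == i_f then model_f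
   else if i == i_h then scalar_polyC lam else 1.
have adbcP : a%:P * d%:P + b%:P * c%:P = 1 :> {poly k}.
  by rewrite -!polyCM -polyCD adbc.
have cdP : c%:P * d%:P = 0 :> {poly k} by rewrite -polyCM cd0.
have dlt2 : dlt%:P * dlt%:P = 1 :> {poly k}.
  by rewrite -polyCM (delta2 adbc cd0).
have mxM (x y : 'M[{poly k}]_2) : x * y = x *m y by [].
have modelE :
    (model_e = mx2 0 (dlt%:P * (d%:P * (lam%:P + (a * b *+ 2)%:P * 'X ^+ 2)
                                - b%:P * 'X ^+ 2)) (- dlt%:P * b%:P) 0)
  * (model_f = mx2 0 (dlt%:P * (a%:P * 'X ^+ 2
                      - c%:P * (lam%:P + (a * b *+ 2)%:P * 'X ^+ 2)))
                   (dlt%:P * a%:P) 0).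
  split; rewrite /model_e /model_f /scalar_polyC !mx2E /model_V /model_W;
    rewrite !mxM !(mx2M, mx2B) -/dlt !(mul0r, mulr0, addr0, add0r, subr0);
    congr mx2; ring.

have dltE : a%:P * d%:P - b%:P * c%:P = dlt%:P :> {poly k}.
  by rewrite -!polyCM -polyCB.
have ef : model_e * model_f + model_f * model_e = scalar_polyC lam.
  rewrite !modelE !mxM !mx2M !mx2D /scalar_polyC mx2E.
  rewrite !(mul0r, mulr0, add0r, addr0).
  set Q := lam%:P + _.
  have E : (a%:P * d%:P + b%:P * c%:P) * Q - a%:P * b%:P * 'X ^+ 2 *+ 2
      = lam%:P.
    by rewrite adbcP /Q polyCMn polyCM; ring.
  congr mx2; rewrite -E -[RHS]mul1r -dlt2; ring.
have uR (r : 'M[{poly k}]_2) :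
    r \in relations (u i_e) (u i_f) (u i_h) (u i_t) -> r = 0.
  rewrite !inE /u /=; case/or4P => [/eqP->|/eqP->|/eqP->|/or3P[]/eqP->].
  - by rewrite mulr1 ef subrr.
  - by rewrite scalar_polyC_comm subrr.
  - by rewrite -scalar_polyC_comm subrr.
  - by rewrite mulr1 mul1r subrr.
  - by rewrite mulr1 mul1r subrr.
  - by rewrite mulr1 mul1r subrr.
pose scalar_polyC_rmorph : {rmorphism k -> 'M[{poly k}]_2} :=
  scalar_mx \o polyC.
have [g [gZ gu]] :=
  Hhat_universal (f := scalar_polyC_rmorph) scalar_polyC_comm uR.
exists g; split=> //; first exact: gu.
- exact: gu.
- rewrite rmorphD !gZ [g (eH k)]gu [g (fH k)]gu /u /= !modelE.
  rewrite /scalar_polyC !mx2E !mxM !mx2M !mx2D /model_W.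
  set Q := lam%:P + _; congr mx2; try ring.
  transitivity (dlt%:P * (a%:P * d%:P - b%:P * c%:P) * Q); first by ring.
  by rewrite dltE dlt2 mul1r.
- rewrite rmorphD !gZ [g (eH k)]gu [g (fH k)]gu /u /= !modelE.
  rewrite /scalar_polyC !mx2E !mxM !mx2M !mx2D /model_V.
  set Q := lam%:P + _; congr mx2; try ring.
    transitivity (dlt%:P * (a%:P * d%:P - b%:P * c%:P) * 'X ^+ 2
       + dlt%:P * Q * (c%:P * d%:P - c%:P * d%:P)); first ring.
    by rewrite dltE dlt2; ring.
  transitivity (dlt%:P * (a%:P * d%:P - b%:P * c%:P)); first by ring.
  by rewrite dltE dlt2.
Qed.

End Model.

Section Independence.

Variables (k : closedFieldType) (U : {vspace 'M[k]_2}).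
Variables (phi : 'Hom(subvs_of U, k^o)) (a b c d : k).
Hypotheses (adbc : a * d + b * c = 1) (cd0 : c * d = 0).
Hypothesis phi0 : fapp phi (a *: e_mx k + b *: f_mx k) = 0.
Local Notation V := (c *: eH k + d *: fH k).

(** The row vector [(1, X)] is an eigenvector of [V] acting on the right, with
eigenvalue [X]. Its value on [V^i] applied to the first basis vector is
therefore [X^i], and a linear relation between the classes of the [V^i t^(n -
i)] becomes a polynomial identity. *)
Lemma line_basis_free n (z : nat -> k) :
  \sum_(i < n.+1) (z i *: (V ^+ i * tH k ^+ (n - i))) *: line_pi phi a b 1
    = 0 ->
  forall i, (i <= n)%N -> z i = 0.
Proof.
under eq_bigr do rewrite -line_piE.
rewrite -line_pi_sum => /line_pi_eq0[x [y]]; rewrite phi0 scale0r subr0.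
set lam := fapp phi _.
have [g [gZ gh gt gW gV]] := line_model lam adbc cd0.
pose e0 : 'cV[{poly k}]_2 := \col_i (i == 0)%:R.
pose l0 : 'rV[{poly k}]_2 := \row_i if i == 0 then 1 else 'X.
move/(congr1 g)/(congr1 (fun A => l0 *m A *m e0)).
have mxM (A B : 'M[{poly k}]_2) : A * B = A *m B by [].
have Ve0 : l0 *m model_V k = 'X *: l0.
  apply/rowP=> j; rewrite !mxE !big_ord_recl big_ord0 !mxE /=.
  by case: (j == 0); ring.
have We0 : model_W a b lam *m e0 = 0.
  apply/colP=> j; rewrite !mxE !big_ord_recl big_ord0 !mxE /=.
  by case: (j == 0); ring.
have VX i : l0 *m model_V k ^+ i = 'X ^+ i *: l0.
  elim: i => [|i IHi]; first by rewrite !expr0 mulmx1 scale1r.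
  by rewrite exprSr mxM mulmxA IHi -scalemxAl Ve0 scalerA -exprSr.
have le0 : l0 *m e0 = 1%:M.
  apply/matrixP=> i j; rewrite !ord1 !mxE !big_ord_recl big_ord0 !mxE /=.
  by ring.
have r1 : g (hH k - lam *: tH k) = 0.
  by rewrite rmorphB gZ gh gt mulr1 subrr.
rewrite rmorphD !rmorphM r1 gW mulr0 add0r !mxM -!mulmxA We0 !mulmx0.
rewrite rmorph_sum mulmx_suml mulmx_sumr.
have E i : l0 *m (g (z i *: (V ^+ i * tH k ^+ (n - i))) *m e0)
    = (z i *: 'X ^+ i)%:M.
  rewrite gZ rmorphM !rmorphXn gV gt expr1n mulr1 mxM -mulmxA mul_scalar_mx.
  rewrite -scalemxAr mulmxA VX -scalemxAl le0 !scale_scalar_mx mulr1.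
  by rewrite mul_polyC.
under eq_bigr do rewrite E.
move/matrixP/(_ 0 0); rewrite summxE mxE.
under eq_bigr do rewrite mxE mulr1n.
rewrite -(poly_def n.+1 z) => /polyP zP i lei.
by have := zP i; rewrite coef_poly ltnS lei coef0.
Qed.

End Independence.

(** * The quotient is a line module *)

Section LineQuotIsLine.

Variables (k : closedFieldType) (U : {vspace 'M[k]_2}).
Variables (phi : 'Hom(subvs_of U, k^o)) (a b : k).
Hypothesis phi0 : fapp phi (a *: e_mx k + b *: f_mx k) = 0.
Local Notation pi := (line_pi phi a b).
Local Notation N := (line_quot phi a b).
Local Notation lam := (fapp phi (h_mx k)).

Lemma line_quot_h_act : hH k *: pi 1 = (lam *: tH k) *: pi 1.
Proof.
apply/subr0_eq; rewrite -scalerBl -line_piE; apply/line_pi_eq0.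
by exists 1, 0; rewrite mul1r mul0r addr0.
Qed.

Lemma line_quot_odd_act : (a *: eH k + b *: fH k) *: pi 1 = 0.
Proof.
rewrite -line_piE; apply/line_pi_eq0.
by exists 0, 1; rewrite mul1r mul0r add0r phi0 scale0r subr0.
Qed.

Section AnyGrading.
Variables (G : zmodType) (w : 'I_4 -> G).

Lemma line_quot_gr_subspace g :
  k_subspace (line_quot_gr (phi := phi) (a := a) (b := b) w g).
Proof.
split=> [|z _ _ [x [xg ->]] [y [yg ->]]].
  by exists 0; rewrite line_pi0; split=> //; apply: Hhat_gr0.
exists (z *: x + y); rewrite line_piD -line_piM mulr_algl; split=> //.
by apply: Hhat_grD => //; apply: Hhat_grZ.
Qed.

Lemma line_quot_decomp (p : {malg k[{fmonom 'I_4}]}) :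
  exists s : seq G, uniq s /\
    pi (piH p) = \sum_(g <- s) pi (piH (hpart w g p)).
Proof.
exists (undup [seq wdeg w m | m <- msupp p]); split; first exact: undup_uniq.
by rewrite {1}[p](hpart_supp_sum w) piH_sum line_pi_sum.
Qed.

Lemma line_quot_gr_hpart g p : line_quot_gr w g (pi (piH (hpart w g p))).
Proof.
exists (piH (hpart w g p)); split=> //; apply/Hhat_grP.
by exists (hpart w g p) => //; apply: hpart_homog.
Qed.

Lemma line_quot_piH (x : N) : exists p, x = pi (piH p).
Proof.
have [y ->] := line_pi_surj x.
by exists (generic_quotient.repr y); rewrite piH_repr.
Qed.

Hypothesis w_efht : w i_e + w i_f = w i_h + w i_t.
Hypotheses (w_ht : w i_h = w i_t) (w_ef : w i_e = w i_f).

Lemma line_quot_graded :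
  graded_module w (line_quot_gr (phi := phi) (a := a) (b := b) w).
Proof.
split; last first.
  move=> i j x _ xi [y [yj ->]]; exists (x * y); rewrite line_piM; split=> //.
  exact: Hhat_grM.
split=> [|//|x _|]; first exact: line_quot_gr_subspace.
  have [p ->] := line_quot_piH x; have [s [s_uniq sE]] := line_quot_decomp p.
  exists s, (fun g => pi (piH (hpart w g p))); split=> // g.
  exact: line_quot_gr_hpart.
exact: line_quot_gr_indep.
Qed.

End AnyGrading.

(** The parity components of a lift that is homogeneous of degree [n] keep
degree [n], as they only use monomials of that lift. *)
Lemma line_quot_bigraded n : direct_sum
  (line_quot_gr (phi := phi) (a := a) (b := b) zwt n)
  (fun p x => line_quot_gr zwt n x /\ line_quot_gr pwt p x).
Proof.
split=> [p|p x []//|x [_ [/Hhat_grP[q qn ->] ->]]|s y s_uniq yP].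
- have [Z0 ZD] := line_quot_gr_subspace zwt n.
  have [P0 PD] := line_quot_gr_subspace pwt p.
  split=> // z x y [xn xp] [yn yp]; split; [exact: ZD|exact: PD].
- have [s [s_uniq sE]] := line_quot_decomp pwt q.
  exists s, (fun g => pi (piH (hpart pwt g q))); split=> // g; split.
    exists (piH (hpart pwt g q)); split=> //; apply/Hhat_grP.
    exists (hpart pwt g q) => // m; rewrite hpartE.
    by case: (wdeg pwt m == g) => [/qn//|]; rewrite eqxx.
  exact: line_quot_gr_hpart.
apply: (line_quot_gr_indep (w := pwt)) => //; try exact/val_inj.
by move=> g; have [] := yP g.
Qed.

Hypothesis ab0 : (a, b) != (0, 0).

(** The classes of the [V^i t^(n - i)] form a basis of the component of degree
[n]. *)
Lemma line_quot_hilbert :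
  hilbert_series (line_quot_gr (phi := phi) (a := a) (b := b) zwt) line_coef.
Proof.
split=> [n|n n0 _ [x [xn ->]]]; last first.
  by rewrite (Hhat_gr_neg n0 xn) line_pi0.
have [c [d [adbc cd0]]] := polar_companion ab0.
pose V := c *: eH k + d *: fH k.
exists (fun i => (V ^+ i * tH k ^+ (n - i)) *: pi 1); split=> [i|].
  rewrite -line_piE; exists (V ^+ i * tH k ^+ (n - i)); split=> //.
  by apply: Hhat_gr_basis; apply: (ltn_ord i).
move=> _ [x [xn ->]]; rewrite line_piE.
have [z zE] := Hhat_spanning adbc cd0 line_quot_h_act line_quot_odd_act xn.
have {}zE : x *: pi 1 = \sum_(i < n.+1)
    (z i)%:A *: ((V ^+ i * tH k ^+ (n - i)) *: pi 1).
  by rewrite zE; apply: eq_bigr => i _; rewrite alg_scale.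
exists [ffun i : 'I_n.+1 => z i]; split.
  by rewrite zE; apply: eq_bigr => i _; rewrite ffunE.
move=> z' z'E; apply/ffunP=> i; rewrite ffunE; apply/eqP; rewrite -subr_eq0.
have := @line_basis_free _ _ _ _ _ _ _ adbc cd0 phi0 n
  (fun j => z j - z' (inord j)).
move=> /(_ _ i); rewrite inord_val => ->//; last by rewrite -ltnS.
rewrite -[RHS](subrr (x *: pi 1)) [in X in _ = X - _]zE z'E -sumrB.
by apply: eq_bigr => j _; rewrite !alg_scale inord_val -scalerBl -scalerBl.
Qed.

Lemma line_quot_is_line :
  @Z2_graded_line_module k (line_quot phi a b)
        (line_quot_gr zwt) (line_quot_gr pwt).
Proof.
split; last exact: line_quot_bigraded.
  split; [exact: line_quot_graded| |exact: line_quot_hilbert].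
  exists (pi 1) => x; have [y ->] := line_pi_surj x; exists y.
  exact: line_piE.
by apply: line_quot_graded => //; apply/val_inj.
Qed.

End LineQuotIsLine.

(** * Linear algebra of graded modules *)

Lemma sum_seq_delta (V : zmodType) (I : eqType) (s : seq I) i (x : V) :
  uniq s -> i \in s -> \sum_(j <- s) (if j == i then x else 0) = x.
Proof.
move=> s_uniq si; rewrite (bigD1_seq _ si s_uniq) /= eqxx big1 ?addr0 //.
by move=> j /negbTE->.
Qed.

Section Subspaces.
Variables (k : closedFieldType) (M : lmodType (Hhat k)) (P : M -> Prop).
Hypothesis Ps : k_subspace P.

Lemma k_subspace0 : P 0. Proof. by case: Ps. Qed.

Lemma k_subspaceZ z x : P x -> P ((z%:A : Hhat k) *: x).
Proof.
by move=> Px; rewrite -[_ *: x]addr0; apply: Ps.2 => //; apply: k_subspace0.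
Qed.

Lemma k_subspaceD x y : P x -> P y -> P (x + y).
Proof.
move=> Px Py; rewrite -[x]scale1r -[1]scale1r.
exact: Ps.2.
Qed.

Lemma k_subspaceN x : P x -> P (- x).
Proof. by move=> Px; rewrite -scaleN1r -[-1]scaleN1r; apply: k_subspaceZ. Qed.

Lemma k_subspaceB x y : P x -> P y -> P (x - y).
Proof. by move=> Px Py; apply: k_subspaceD => //; apply: k_subspaceN. Qed.

Lemma k_subspace_sum (I : Type) (r : seq I) (Q : pred I) (F : I -> M) :
  (forall i, P (F i)) -> P (\sum_(i <- r | Q i) F i).
Proof.
by move=> PF; elim/big_ind: _ => //; [exact: k_subspace0|exact: k_subspaceD].
Qed.

Section Dimension.
Variable n : nat.
Hypothesis Pn : has_dim P n.

Lemma has_dim_coords m (x : 'I_m -> M) : (forall i, P (x i)) ->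
  forall b : 'I_n -> M, (forall x, P x ->
      exists! c : {ffun 'I_n -> k}, x = \sum_i ((c i)%:A : Hhat k) *: b i) ->
  exists C : 'M[k]_(m, n), forall i, x i = \sum_j (C i j)%:A *: b j.
Proof.
move=> Px b bP.
have /choice[C CE] i :
    exists c : {ffun 'I_n -> k}, x i = \sum_j (c j)%:A *: b j.
  by have [c [cE _]] := bP _ (Px i); exists c.
exists (\matrix_(i, j) C i j) => i; rewrite CE.
by apply: eq_bigr => j _; rewrite mxE.
Qed.

Lemma comb_mulmx p m q (A : 'M[k]_(p, m)) (C : 'M[k]_(m, q)) (b : 'I_q -> M) i :
  \sum_j (A i j)%:A *: (\sum_l (C j l)%:A *: b l)
  = \sum_l ((A *m C) i l)%:A *: b l :> M.
Proof.
under eq_bigr do rewrite scaler_sumr.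
rewrite exchange_big; apply: eq_bigr => l _; rewrite mxE !scaler_suml.
by apply: eq_bigr => j _; rewrite alg_scale scalerA.
Qed.

Lemma has_dim_dependent (x : 'I_n.+1 -> M) : (forall i, P (x i)) ->
  exists z : 'I_n.+1 -> k,
    (exists i, z i != 0) /\ \sum_i (z i)%:A *: x i = 0.
Proof.
move=> Px; have [b [_ bP]] := Pn; have [C CE] := has_dim_coords Px bP.
have /rowV0Pn[z /sub_kermxP zC z0] : kermx C != 0.
  by rewrite -mxrank_eq0 mxrank_ker subn_eq0 -ltnNge ltnS rank_leq_col.
exists (z 0); split.
  by have /rV0Pn[i zi] := z0; exists i.
under eq_bigr do rewrite CE.
by rewrite comb_mulmx zC big1 // => l _; rewrite mxE !scale0r.
Qed.

(** The coordinates of [u] in a basis and those of that basis in [u] form two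
square matrices, one being a left inverse of the other, hence also a right
inverse. *)
Lemma has_dim_span_free (u : 'I_n -> M) : (forall i, P (u i)) ->
  (forall x, P x -> exists z : 'I_n -> k, x = \sum_i (z i)%:A *: u i) ->
  forall z : 'I_n -> k, \sum_i (z i)%:A *: u i = 0 -> forall i, z i = 0.
Proof.
move=> Pu uP z z0 i; have [b [Pb bP]] := Pn.
have [C CE] := has_dim_coords Pu bP.
have coord_inj (y y' : 'rV[k]_n) : \sum_l (y 0 l)%:A *: b l
    = \sum_l (y' 0 l)%:A *: b l -> y = y'.
  move=> E; have [|c [_ cU]] := bP (\sum_l (y 0 l)%:A *: b l).
    by apply: k_subspace_sum => l; apply: k_subspaceZ.
  have cy (w : 'rV[k]_n) :
      \sum_l (y 0 l)%:A *: b l = \sum_l (w 0 l)%:A *: b l ->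
      c = [ffun l => w 0 l].
    by move=> wE; apply: cU; rewrite wE; apply: eq_bigr => l _; rewrite ffunE.
  apply/rowP=> l; have := cy y' E; rewrite (cy y erefl) => /ffunP/(_ l).
  by rewrite !ffunE.
have /choice[D0 D0E] j : exists y : 'I_n -> k, b j = \sum_i (y i)%:A *: u i.
  exact: uP.
pose D := \matrix_(j, i) D0 j i.
have DC : D *m C = 1%:M.
  apply/row_matrixP=> j; apply: coord_inj.
  transitivity (b j).
    under eq_bigr do rewrite mxE; rewrite -comb_mulmx [RHS]D0E.
    by apply: eq_bigr => l _; rewrite mxE CE.
  rewrite (bigD1 j) //= big1 => [|l lj]; rewrite !mxE.
    by rewrite eqxx addr0 !scale1r.
  by rewrite eq_sym (negbTE lj) !scale0r.
have CD := mulmx1C DC.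
pose zr := \row_i z i.
have : zr *m C = 0.
  apply: coord_inj; rewrite -comb_mulmx [RHS]big1 => [|l _]; last first.
    by rewrite mxE !scale0r.
  by rewrite -[RHS]z0; apply: eq_bigr => l _; rewrite mxE CE.
move/(congr1 (mulmx^~ D)); rewrite -mulmxA CD mulmx1 mul0mx => /rowP/(_ i).
by rewrite !mxE.
Qed.

End Dimension.

End Subspaces.

Section DirectSums.
Variables (k : closedFieldType) (M : lmodType (Hhat k)).
Variables (I : eqType) (W : M -> Prop) (P : I -> M -> Prop).
Hypothesis PW : direct_sum W P.

(** Comparison of components, for a sum whose terms may repeat degrees. The
value [0] off the degree of [x] is kept in the statement since vanishing
components are used as much as the other one. *)
Lemma direct_sum_component (T : eqType) (r : seq T) (deg : T -> I)
    (y : T -> M) i x :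
  (forall l, P (deg l) (y l)) -> P i x -> x = \sum_(l <- r) y l ->
  forall j, \sum_(l <- r | deg l == j) y l = if j == i then x else 0.
Proof.
case: PW => Psub _ _ Pind Py Px xE j.
pose s := undup [:: j, i & map deg r].
(* The family of all the differences is homogeneous with sum zero. *)
pose z j := \sum_(l <- r | deg l == j) y l - (if j == i then x else 0).
have zP l : P l (z l).
  apply: k_subspaceB => //; last by case: eqP => [->//|_]; apply: k_subspace0.
  rewrite big_mkcond; apply: k_subspace_sum => // l'.
  by case: eqP => [<-//|_]; apply: k_subspace0.
apply/subr0_eq/(Pind s z (undup_uniq _) zP); last by rewrite mem_undup mem_head.
rewrite sumrB.
have -> : \sum_(l <- s) (if l == i then x else 0) = x.
  by rewrite sum_seq_delta ?undup_uniq // mem_undup !inE eqxx orbT.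
apply/eqP; rewrite subr_eq0 [X in _ == X]xE; apply/eqP.
under eq_bigr do rewrite big_mkcond.
rewrite exchange_big; apply: eq_big_seq => l lr.
under eq_bigr do rewrite eq_sym.
by rewrite sum_seq_delta ?undup_uniq // mem_undup !inE map_f ?orbT.
Qed.

End DirectSums.

Lemma direct_sum2 (k : closedFieldType) (M : lmodType (Hhat k)) (I : eqType)
    (W : M -> Prop) (P : I -> M -> Prop) i j x y :
  direct_sum W P -> i != j -> P i x -> P j y -> x + y = 0 -> x = 0 /\ y = 0.
Proof.
move=> [Psub _ _ Pind] ij xi yj xy0.
pose z l := if l == i then x else if l == j then y else 0.
have zP l : P l (z l).
  rewrite /z; case: eqP => [->//|_]; case: eqP => [->//|_].
  exact: k_subspace0 (Psub l).
have zi : z i = x by rewrite /z eqxx.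
have zj : z j = y by rewrite /z eq_sym (negbTE ij) eqxx.
have ij_uniq : uniq [:: i; j] by rewrite /= inE ij.
have z0 : \sum_(l <- [:: i; j]) z l = 0.
  by rewrite !big_cons big_nil zi zj addr0.
have zeq0 := Pind _ z ij_uniq zP z0.
by split; [rewrite -zi | rewrite -zj]; apply: zeq0; rewrite !inE eqxx ?orbT.
Qed.

(** The components of [a] send [v] into distinct components of the module, so
only the one of weight [g - d] contributes to [x]. *)
Lemma graded_lift (k : closedFieldType) (G : zmodType) (w : 'I_4 -> G)
    (M : lmodType (Hhat k)) (P : G -> M -> Prop) (v : M) (d g : G) (x : M) :
  graded_module w P -> P d v -> (exists a : Hhat k, x = a *: v) -> P g x ->
  exists y, Hhat_gr w (g - d) y /\ x = y *: v.
Proof.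
move=> [Pds PM] vd [a xE] xg.
have [s [y [_ yP _ aE]]] := Hhat_decomp w a.
have := direct_sum_component Pds (r := s) (deg := fun i => i + d)
  (y := fun i => y i *: v) (fun i => PM _ _ _ _ (yP i) vd) xg _ g.
rewrite eqxx => <-; last by rewrite xE aE scaler_suml.
elim/big_ind: _ => [|_ _ [b [bP ->]] [b' [b'P ->]]|i /eqP <-].
- by exists 0; rewrite scale0r; split=> //; apply: Hhat_gr0.
- by exists (b + b'); rewrite scalerDl; split=> //; apply: Hhat_grD.
- by exists (y i); rewrite addrK.
Qed.

Lemma alg_scaleK (k : fieldType) (A : algType k) (M : lmodType A) (z : k)
    (x : M) :
  z != 0 -> (z^-1%:A : A) *: (z%:A *: x) = x.
Proof. by move=> z0; rewrite alg_scale scalerA mulVf // !scale1r. Qed.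

Lemma alg_scale_solve (k : fieldType) (A : algType k) (M : lmodType A)
    (u z : k) (x y : M) : u != 0 -> (u%:A : A) *: x + (z%:A : A) *: y = 0 ->
  x = ((- (u^-1 * z))%:A : A) *: y.
Proof.
move=> u0 /eqP; rewrite addr_eq0 => /eqP E.
rewrite -[LHS](alg_scaleK x u0) E scalerN alg_scale scalerA.
by rewrite scaleNr scaleNr.
Qed.

(** * Classification of torsion-free line modules *)

Section LineGenerator.
Variables (k : closedFieldType) (M : lmodType (Hhat k)) (MZ : int -> M -> Prop).
Hypothesis ML : line_module MZ.

Let Mgr : graded_module zwt MZ. Proof. by case: ML. Qed.
Let Mds : direct_sum (fun _ => True) MZ. Proof. by case: Mgr. Qed.
Let Msub n : k_subspace (MZ n). Proof. by case: Mds. Qed.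
Let Mdim n : has_dim (MZ n%:Z) n.+1. Proof. by case: ML => _ _ []. Qed.
Let Mneg n x : n < 0 -> MZ n x -> x = 0.
Proof. by move=> n0; case: ML => _ _ [_]; apply. Qed.

Lemma direct_sum_decomp x : exists (s : seq int) (y : int -> M),
  [/\ uniq s, forall n, MZ n (y n), forall n, n \notin s -> y n = 0
    & x = \sum_(n <- s) y n].
Proof.
have [_ _ Mex _] := Mds; have [s [y [s_uniq yP xE]]] := Mex x I.
exists s, (fun n => if n \in s then y n else 0); split=> // [n|n /negbTE->//|].
  by case: ifP => // _; apply: k_subspace0 (Msub n).
by rewrite xE; apply: eq_big_seq => n ->.
Qed.

Lemma line_degree0 v x : MZ 0 v -> v != 0 -> MZ 0 x ->
  exists z : k, x = (z%:A : Hhat k) *: v.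
Proof.
move=> v0 vn0 x0.
have [|z [[i zi] ]] :=
  has_dim_dependent (Mdim 0) (x := fun i => if i == 0 then v else x).
  by move=> i; case: ifP.
rewrite !big_ord_recl big_ord0 /= addr0 => E.
set z0 := z ord0 in E; set z1 := z (lift ord0 ord0) in E.
have z1n0 : z1 != 0.
  apply/eqP=> z10; move: E; rewrite z10 !scale0r addr0 => E.
  have [z00|z00] := eqVneq z0 0; last first.
    move/negP: vn0; apply; apply/eqP.
    by rewrite -(alg_scaleK v z00) E scaler0.
  move/negP: zi; apply; case: i => [[|[|]]] // lt.
  - by rewrite (_ : Ordinal lt = ord0) -/z0 ?z00 //; apply: val_inj.
  - by rewrite (_ : Ordinal lt = lift ord0 ord0) -/z1 ?z10 //; apply: val_inj.
exists (- (z1^-1 * z0)); apply: alg_scale_solve z1n0 _.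
by rewrite addrC.
Qed.

(** The given cyclic generator [m] need not be homogeneous. Write [x = a m]
with [x] of degree [n], and compare components. In degree zero only [a_0 m_0]
survives, since [Hhat] and the module live in nonnegative degrees; as [m_0 !=
0], this forces [a_0 = 0] when [n > 0]. In degree [n], [x] is then a sum of
[a_i m_j] with [j < n], and induction applies. *)
Lemma line_generator v : MZ 0 v -> v != 0 ->
  forall x, exists a : Hhat k, x = a *: v.
Proof.
move=> v0 vn0; have [_ [m mgen] _] := ML.
have [sm [mm [sm_uniq mmP mm0 mE]]] := direct_sum_decomp m.
have key n x a : MZ n x -> x = a *: m ->
  exists (sa : seq int) (aa : int -> Hhat k),
  [/\ uniq sa, forall g, Hhat_gr zwt g (aa g), forall g, g \notin sa -> aa g = 0
    & forall g, \sum_(p <- [seq (i, j) | i <- sa, j <- sm] | p.1 + p.2 == g)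
         aa p.1 *: mm p.2 = if g == n then x else 0].
  move=> xn xE; have [sa [aa [sa_uniq aaP aa0 aE]]] := Hhat_decomp zwt a.
  exists sa, aa; split=> // g.
  apply: (direct_sum_component Mds (deg := fun p : int * int => p.1 + p.2)
    (y := fun p : int * int => aa p.1 *: mm p.2)) => //.
    by move=> p; apply: Mgr.2.
  rewrite big_allpairs /= xE aE mE scaler_suml; apply: eq_bigr => i _.
  by rewrite scaler_sumr.
(* A term of total degree zero vanishes unless both of its factors have degree
   zero: one of the two has negative degree. *)
have term0 aa i j : Hhat_gr zwt i aa -> i + j = 0 -> (i, j) != (0, 0) ->
    aa *: mm j = 0.
  move=> ai ij0 ij; have [i0|i0|i0] := ltgtP i 0.
  - by rewrite (Hhat_gr_neg i0 ai) scale0r.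
  - rewrite (Mneg (n := j) _ (mmP j)) ?scaler0 //.
    by move/eqP: ij0; rewrite addrC addr_eq0 => /eqP ->; rewrite oppr_lt0.
  - by move: ij ij0; rewrite i0 add0r => /eqP ij j0; case: ij; rewrite j0.
have mm00 : mm 0 != 0.
  apply: contra vn0 => /eqP m00; have [a va] := mgen v.
  have [sa [aa [_ aaP _ /(_ 0)]]] := key 0 v a v0 va; rewrite eqxx => <-.
  rewrite big1 // => -[i j] /= /eqP ij0.
  have [[i0 j0]|ij] := eqVneq (i, j) (0, 0); last exact: term0 ij.
  by rewrite j0 m00 scaler0.
suff gen n : forall x, MZ n%:Z x -> exists a : Hhat k, x = a *: v.
  move=> x; have [s [y [_ yP _ ->]]] := direct_sum_decomp x.
  elim/big_ind: _ => [|_ _ [a ->] [a' ->]|[n|n] _].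
  - by exists 0; rewrite scale0r.
  - by exists (a + a'); rewrite scalerDl.
  - exact: gen (yP n).
  - by exists 0; rewrite scale0r (Mneg _ (yP (Negz n))).
elim/ltn_ind: n => n IHn x xn.
have [n0|n0] := eqVneq n 0%N.
  rewrite n0 in xn; have [z ->] := line_degree0 v0 vn0 xn.
  by eexists.
have [a xa] := mgen x.
have [sa [aa [sa_uniq aaP aa0 comp]]] := key _ _ a xn xa.
have a00 : aa 0 = 0.
  have [s0|/aa0//] := boolP (0 \in sa).
  have [m0|/mm0 m0] := boolP (0 \in sm); last by rewrite m0 eqxx in mm00.
  have pairs_uniq : uniq [seq (i, j) | i <- sa, j <- sm].
    by apply: allpairs_uniq => // -[? ?] [? ?] _ _.
  have pairs0 : (0, 0) \in [seq (i, j) | i <- sa, j <- sm].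
    exact: allpairs_f.
  have := comp 0; rewrite big_mkcond (bigD1_seq _ pairs0 pairs_uniq) /=.
  rewrite big1 => [|[i j] ij]; last first.
    by case: eqP => //= ij0; apply: term0 ij.
  rewrite addr0 eq_sym eqz_nat (negbTE n0).
  have [z ->] := Hhat_gr_zero (aaP 0).
  have [->|z0] := eqVneq z 0; first by rewrite scale0r.
  move=> E; move/negP: mm00; case; apply/eqP.
  by rewrite -(alg_scaleK (mm 0) z0) E scaler0.
have := comp n%:Z; rewrite eqxx => <-.
elim/big_ind: _ => [|_ _ [b ->] [b' ->]|[i j] /= /eqP ij].
- by exists 0; rewrite scale0r.
- by exists (b + b'); rewrite scalerDl.
case: i ij => [[|i]|i] ij; first by exists 0; rewrite a00 !scale0r.
  case: j ij => [j|j] ij; last first.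
    by exists 0; rewrite (Mneg _ (mmP (Negz j))) // scaler0 scale0r.
  have [|b ->] := IHn j _ _ (mmP j); last first.
    by exists (aa i.+1 * b); rewrite scalerA.
  by move: ij => [<-]; rewrite ltnS leq_addl.
by exists 0; rewrite (Hhat_gr_neg _ (aaP (Negz i))) // !scale0r.
Qed.

End LineGenerator.

Lemma Z2_addxx (s : 'Z_2) : s + s = 0.
Proof. by case: s => [[|[|]]] // lt; apply: val_inj. Qed.

Section Classification.

Variables (k : closedFieldType) (L : lmodType (Hhat k)).
Variables (LZ : int -> L -> Prop) (LP : 'Z_2 -> L -> Prop).
Hypotheses (Lline : Z2_graded_line_module LZ LP) (Ltf : t_torsionfree L).

Let LZline : line_module LZ. Proof. by case: Lline. Qed.
Let LZgr : graded_module zwt LZ. Proof. by case: LZline. Qed.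
Let LPgr : graded_module pwt LP. Proof. by case: Lline. Qed.
Let LZsub n : k_subspace (LZ n). Proof. by case: LZgr => -[]. Qed.
Let LPsub p : k_subspace (LP p). Proof. by case: LPgr => -[]. Qed.
Let Ldim n : has_dim (LZ n%:Z) n.+1. Proof. by case: LZline => _ _ []. Qed.

(** [L_0] is a line and the sum of its parity components, so a nonzero parity
component of a basis vector exists. *)
Lemma homogeneous_generator : exists (v : L) (s : 'Z_2),
  [/\ LZ 0 v, LP s v & v != 0].
Proof.
have [b [b0 bP]] := Ldim 0.
have bn0 : b ord0 != 0.
  apply/eqP=> b00; have [|c [_ cU]] := bP 0; first exact: k_subspace0 (LZsub 0).
  have E (z : k) : c = [ffun => z].
    by apply: cU; rewrite big_ord_recl big_ord0 b00 scaler0 addr0.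
  have := E 0; rewrite (E 1) => /ffunP/(_ ord0); rewrite !ffunE.
  by move/eqP; rewrite oner_eq0.
have [_ _ /(_ 0)[_ _ Lex _]] := Lline.
have [s [y [_ yP yE]]] := Lex _ (b0 ord0).
have [[p yp]|all0] := pselect (exists p, y p != 0).
  by exists (y p), p; have [] := yP p.
case/negP: bn0; rewrite yE big1 // => p _.
by apply/eqP; apply: contraPT all0 => yp; apply; exists p.
Qed.

Section WithGenerator.

Variables (v : L) (s : 'Z_2).
Hypotheses (v0 : LZ 0 v) (vs : LP s v) (vn0 : v != 0).

Let gen1 i : LZ 1 (piH (gen k i) *: v).
Proof.
by rewrite -[1]addr0; apply: LZgr.2 => //; apply: (Hhat_gr_gen k zwt i).
Qed.
Let ev : LP (1 + s) (eH k *: v).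
Proof. by apply: LPgr.2 => //; apply: (Hhat_gr_gen k pwt i_e). Qed.
Let fv : LP (1 + s) (fH k *: v).
Proof. by apply: LPgr.2 => //; apply: (Hhat_gr_gen k pwt i_f). Qed.
Let hv : LP s (hH k *: v).
Proof.
by rewrite -[s]add0r; apply: LPgr.2 => //; apply: (Hhat_gr_gen k pwt i_h).
Qed.
Let tv : LP s (tH k *: v).
Proof.
by rewrite -[s]add0r; apply: LPgr.2 => //; apply: (Hhat_gr_gen k pwt i_t).
Qed.

Let tvn0 : tH k *: v != 0.
Proof. by apply: contra vn0 => /eqP/Ltf ->. Qed.

Let s_neq : 1 + s != s.
Proof. by rewrite -[X in _ != X]add0r (inj_eq (addIr s)). Qed.

Lemma degree1_dependent (x1 x2 x3 : L) : LZ 1 x1 -> LZ 1 x2 -> LZ 1 x3 ->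
  exists z1 z2 z3 : k, (z1, z2, z3) != (0, 0, 0) /\
  (z1%:A : Hhat k) *: x1 + (z2%:A : Hhat k) *: x2 + (z3%:A : Hhat k) *: x3 = 0.
Proof.
move=> P1 P2 P3; pose x (i : 'I_3) := nth x1 [:: x1; x2; x3] i.
have [|z [[r zr] ]] := has_dim_dependent (Ldim 1) (x := x).
  by case=> [[|[|[|]]]].
rewrite !big_ord_recl big_ord0 addr0 addrA => E.
exists (z ord0), (z (lift ord0 ord0)), (z (lift ord0 (lift ord0 ord0))).
split; first last; first exact: E.
apply: contra zr => /eqP[z0 z1 z2]; case: r => [[|[|[|]]]] // lt.
- by rewrite (_ : Ordinal lt = ord0) ?z0 //; apply: val_inj.
- by rewrite (_ : Ordinal lt = lift ord0 ord0) ?z1 //; apply: val_inj.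
- rewrite (_ : Ordinal lt = lift ord0 (lift ord0 ord0)) ?z2 //.
  exact: val_inj.
Qed.

(** In a dependency between [e v], [f v] and [t v] the coefficient of [t v]
vanishes, for it is the only term of its parity and [t v != 0]. *)
Lemma odd_relation : exists a b : k,
  (a, b) != (0, 0) /\ (a *: eH k + b *: fH k) *: v = 0.
Proof.
have [a [b [z [abz E]]]] :=
  degree1_dependent (gen1 i_e) (gen1 i_f) (gen1 i_t).
have [| |E1 E2] := direct_sum2 LPgr.1 s_neq _ _ E.
- apply: (k_subspaceD (LPsub _)); [exact: (k_subspaceZ (LPsub _) _ ev)|].
  exact: (k_subspaceZ (LPsub _) _ fv).
- exact: (k_subspaceZ (LPsub _) _ tv).
exists a, b; split; first last.
  by rewrite scalerDl -(alg_scale a) -(alg_scale b); apply: E1.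
have [z0|z0] := eqVneq z 0.
  by apply: contra abz => /eqP[-> ->]; rewrite z0.
case/negP: tvn0; apply/eqP; rewrite -[LHS](alg_scaleK _ z0).
by rewrite [X in _ *: X]E2 scaler0.
Qed.

(** A dependency between [x], [h v] and [t v], with [x] of the parity of [e
v], splits into a multiple of [x] and a relation between [h v] and [t v]. So
[x = 0] or [h v] is a multiple of [t v]. If the former happens for both [e v]
and [f v], the relation [e f + f e = h t] gives [t h v = 0], and [h v = 0] by
torsion-freeness. *)
Lemma even_relation : exists lam : k, hH k *: v = (lam *: tH k) *: v.
Proof.
have oddzero x : LZ 1 x -> LP (1 + s) x ->
    (exists lam : k, hH k *: v = (lam *: tH k) *: v) \/ x = 0.
  move=> x1 xs; have [z1 [z2 [z3 [zn0 E]]]] :=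
    degree1_dependent x1 (gen1 i_h) (gen1 i_t).
  rewrite -addrA in E.
  have [| |E1 E2] := direct_sum2 LPgr.1 s_neq _ _ E.
  - exact: (k_subspaceZ (LPsub _) _ xs).
  - apply: (k_subspaceD (LPsub _)); [exact: (k_subspaceZ (LPsub _) _ hv)|].
    exact: (k_subspaceZ (LPsub _) _ tv).
  have {}E2 : z2%:A *: (hH k *: v) + z3%:A *: (tH k *: v) = 0 := E2.
  have [z10|z10] := eqVneq z1 0; last first.
    by right; rewrite -[LHS](alg_scaleK _ z10) E1 scaler0.
  left; have [z20|z20] := eqVneq z2 0.
    have [z30|z30] := eqVneq z3 0; first by rewrite z10 z20 z30 eqxx in zn0.
    case/negP: tvn0; apply/eqP; rewrite -[LHS](alg_scaleK _ z30).
    by move: E2; rewrite z20 !scale0r add0r => ->; rewrite scaler0.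
  exists (- (z2^-1 * z3)); rewrite -(alg_scale (- (z2^-1 * z3))).
  exact: alg_scale_solve z20 E2.
have [//|e0] := oddzero _ (gen1 i_e) ev.
have [//|f0] := oddzero _ (gen1 i_f) fv.
exists 0; rewrite !scale0r; apply: Ltf.
by rewrite scalerA -comm_ht -relE_ef scalerDl -!scalerA [eH k *: v]e0
  [fH k *: v]f0 !scaler0 addr0.
Qed.

Lemma line_pi0_annihilates (U : {vspace 'M[k]_2})
    (phi : 'Hom(subvs_of U, k^o)) a b (x : Hhat k) :
  hH k *: v = (fapp phi (h_mx k) *: tH k) *: v ->
  (a *: eH k + b *: fH k) *: v = 0 ->
  fapp phi (a *: e_mx k + b *: f_mx k) = 0 ->
  line_pi phi a b x = 0 -> x *: v = 0.
Proof.
move=> hvE Wv phi0 /line_pi_eq0[y [z ->]].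
rewrite phi0 scale0r subr0 scalerDl -scalerA scalerBl hvE subrr scaler0 add0r.
by rewrite -scalerA Wv scaler0.
Qed.

(** It is enough to treat the component [y n] of degree [n]. Modulo the left
ideal it is a combination of the [V^i t^(n - i)], and so is its action on [v];
these [n + 1] vectors span [L_n], which has dimension [n + 1], so they are
independent and the combination is trivial. *)
Lemma annihilates_line_pi0 (U : {vspace 'M[k]_2})
    (phi : 'Hom(subvs_of U, k^o)) a b (x : Hhat k) :
  (a, b) != (0, 0) ->
  hH k *: v = (fapp phi (h_mx k) *: tH k) *: v ->
  (a *: eH k + b *: fH k) *: v = 0 ->
  fapp phi (a *: e_mx k + b *: f_mx k) = 0 ->
  x *: v = 0 -> line_pi phi a b x = 0.
Proof.
move=> ab0 hvE Wv phi0 xv0.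
have [c [d [adbc cd0]]] := polar_companion ab0.
have [r [y [r_uniq yP y0 xE]]] := Hhat_decomp zwt x.
have yv0 n : y n *: v = 0.
  have [nr|/y0->] := boolP (n \in r); last by rewrite scale0r.
  have yvP i : LZ i (y i *: v).
    by have := LZgr.2 _ _ _ _ (yP i) v0; rewrite addr0.
  have sum0 : 0 = \sum_(i <- r) y i *: v by rewrite -scaler_suml -xE.
  have := direct_sum_component LZgr.1 (deg := id) yvP
    (k_subspace0 (LZsub n)) sum0 n.
  rewrite if_same big_mkcond (bigD1_seq _ nr r_uniq) /= eqxx big1 ?addr0 //.
  by move=> i /negbTE->.
rewrite xE line_pi_sum big1 // => -[n|n] _; last first.
  by rewrite (Hhat_gr_neg _ (yP (Negz n))) // line_pi0.
have {yP} yn := yP n%:Z.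
pose B (i : 'I_n.+1) := (c *: eH k + d *: fH k) ^+ i * tH k ^+ (n - i).
have [z zE] := Hhat_spanning adbc cd0
  (line_quot_h_act phi a b) (line_quot_odd_act phi0) yn.
have Bv (i : 'I_n.+1) : LZ n%:Z (B i *: v).
  rewrite -[n%:Z]addr0; apply: LZgr.2 => //; apply: Hhat_gr_basis.
  exact: (ltn_ord i).
have Bspan u : LZ n%:Z u ->
    exists z' : 'I_n.+1 -> k, u = \sum_i ((z' i)%:A : Hhat k) *: (B i *: v).
  move=> un; have [u' []] :=
    graded_lift LZgr v0 (line_generator LZline v0 vn0 u) un.
  rewrite subr0 => u'n ->.
  have [z' ->] := Hhat_spanning adbc cd0 hvE Wv u'n.
  by exists (fun i => z' i); apply: eq_bigr => i _; rewrite alg_scale.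
pose S := \sum_(i < n.+1) z i *: B i.
have piS : line_pi phi a b (y n%:Z - S) = 0.
  by rewrite line_piE scalerBl [X in X - _]zE /S scaler_suml subrr.
have Sv0 : S *: v = 0.
  have := line_pi0_annihilates hvE Wv phi0 piS.
  by rewrite scalerBl yv0 sub0r => /eqP; rewrite oppr_eq0 => /eqP.
have z0 : forall i : 'I_n.+1, z i = 0.
  apply: (has_dim_span_free (LZsub n%:Z) (Ldim n) Bv Bspan).
  rewrite -[RHS]Sv0 /S scaler_suml; apply: eq_bigr => i _; exact: alg_scale.
by rewrite line_piE [LHS]zE big1 // => i _; rewrite z0 !scale0r.
Qed.

(** By the two preceding lemmas, [x v] and the class of [x] determine each
other. The parity [s] of [v] is the shift between the two parity gradings. *)
Lemma line_isomorphic (U : {vspace 'M[k]_2}) (phi : 'Hom(subvs_of U, k^o)) a b :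
  (a, b) != (0, 0) ->
  hH k *: v = (fapp phi (h_mx k) *: tH k) *: v ->
  (a *: eH k + b *: fH k) *: v = 0 ->
  fapp phi (a *: e_mx k + b *: f_mx k) = 0 ->
  @graded_isomorphic k L (line_quot phi a b)
              LZ LP (line_quot_gr zwt) (line_quot_gr pwt).
Proof.
move=> ab0 hvE Wv phi0.
have pi_eq (x y : Hhat k) :
    line_pi phi a b x = line_pi phi a b y <-> x *: v = y *: v.
  have piB : line_pi phi a b (x - y) = line_pi phi a b x - line_pi phi a b y.
    by rewrite line_piE scalerBl -!line_piE.
  split=> E; apply/subr0_eq.
    rewrite -scalerBl; apply: (line_pi0_annihilates hvE Wv phi0).
    by rewrite piB E subrr.
  rewrite -piB; apply: (annihilates_line_pi0 ab0 hvE Wv phi0).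
  by rewrite scalerBl E subrr.
have /choice[a_ aE] := line_generator LZline v0 vn0.
pose g0 x := line_pi phi a b (a_ x).
have g0E x : g0 (x *: v) = line_pi phi a b x by apply/pi_eq; rewrite -aE.
have g0lin : linear g0.
  move=> x y z; rewrite [y]aE [z]aE scalerA -scalerDl !g0E line_piD.
  by rewrite line_piM.
pose g0L := GRing.isLinear.Build _ _ _ _ g0 g0lin.
pose g : {linear L -> line_quot phi a b} := HB.pack g0 g0L.
exists g, s; split.
- pose h (y : line_quot phi a b) : L := generic_quotient.repr y *: v.
  exists h => [x|y].
    by rewrite [RHS]aE /h; apply/pi_eq; rewrite /line_pi lmod_pi_repr.
  by rewrite [LHS]g0E /line_pi lmod_pi_repr.
- move=> n x; split=> [xn|[y [yn xE]]].
    have [y [yn ->]] := graded_lift LZgr v0 (ex_intro _ _ (aE x)) xn.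
    by exists y; rewrite [LHS]g0E -[n]subr0.
  have -> : x = y *: v by rewrite [x]aE; apply/pi_eq.
  by rewrite -[n]addr0; apply: LZgr.2.
- move=> p x; split=> [xp|[y [yp xE]]].
    have [y [yp ->]] := graded_lift LPgr vs (ex_intro _ _ (aE x)) xp.
    exists y; rewrite [LHS]g0E; split=> //; move: yp.
    suff -> : p - s = s + p by [].
    by apply/eqP; rewrite subr_eq addrAC Z2_addxx add0r.
  have -> : x = y *: v by rewrite [x]aE; apply/pi_eq.
  have -> : p = s + p + s by rewrite addrAC Z2_addxx add0r.
  exact: LPgr.2.
Qed.

End WithGenerator.
End Classification.

(** [phi] is [lam] times the upper left entry, which is one on [h] and zero on
off-diagonal matrices. *)
Lemma presented_functional (k : closedFieldType) (a b lam : k) :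
  (a, b) != (0, 0) ->
  exists (U : {vspace 'M[k]_2}) (phi : 'Hom(subvs_of U, k^o)),
    [/\ presents U a b, fapp phi (h_mx k) = lam
      & fapp phi (a *: e_mx k + b *: f_mx k) = 0].
Proof.
move=> ab0; set x := a *: e_mx k + b *: f_mx k.
pose U := (<[h_mx k]> + <[x]>)%VS.
have hU : h_mx k \in U by apply: (subvP (addvSl _ _)); apply: memv_line.
have xU : x \in U by apply: (subvP (addvSr _ _)); apply: memv_line.
pose F (u : subvs_of U) : k^o := lam * (vsval u) 0 0.
have Flin : linear F.
  by move=> z u u'; rewrite /F linearP /= !mxE /GRing.scale /=; ring.
pose FL := GRing.isLinear.Build _ _ _ _ F Flin.
pose Fl : {linear subvs_of U -> k^o} := HB.pack F FL.
exists U, (linfun Fl); split=> //.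
  by rewrite /fapp lfunE /= /F vsprojK // mxE mulr1n mulr1.
by rewrite /fapp lfunE /= /F vsprojK // !mxE /=; ring.
Qed.

Theorem proposition2p5 (k : closedFieldType) (char2 : 2%N \notin [pchar k]) :
  (forall (U : {vspace 'M[k]_2}) (phi : 'Hom(subvs_of U, k^o)) (a b : k),
      subalgebra U -> \dim U = 2%N -> presents U a b ->
      fapp phi (a *: e_mx k + b *: f_mx k) = 0 ->
      @Z2_graded_line_module k (line_quot phi a b)
        (line_quot_gr zwt) (line_quot_gr pwt))
  /\
  (forall (L : lmodType (Hhat k))
          (LZ : int -> L -> Prop) (LP : 'Z_2 -> L -> Prop),
      Z2_graded_line_module LZ LP -> t_torsionfree L ->
      exists (U : {vspace 'M[k]_2}) (phi : 'Hom(subvs_of U, k^o)) (a b : k),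
        [/\ subalgebra U, \dim U = 2%N, presents U a b,
            fapp phi (a *: e_mx k + b *: f_mx k) = 0
          & @graded_isomorphic k L (line_quot phi a b)
              LZ LP (line_quot_gr zwt) (line_quot_gr pwt)]).
Proof.
split=> [U phi a b _ _ [ab0 _] phi0|L LZ LP Lline Ltf].
  exact: line_quot_is_line.
have [v [s [v0 vs vn0]]] := homogeneous_generator Lline.
have [a [b [ab0 Wv]]] := odd_relation Lline Ltf v0 vs vn0.
have [lam hv] := even_relation Lline Ltf v0 vs vn0.
have [U [phi [Uab phih phi0]]] := presented_functional lam ab0.
have [|Usub Udim] := (subalgebra2P U char2).2; first by exists a, b.
exists U, phi, a, b; split=> //.
by apply: (line_isomorphic Lline v0 vs vn0 ab0 _ Wv phi0); rewrite phih.
Qed.
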